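(* Let $r\ge1$. The map $f\mapsto f|J$, where $(f|J)(\Lambda)=f(J^{-1}\Lambda)$, is an action of the group $\mathcal J(A)\ni J$ of fractional ideals on $\mathbf{Strong}^{k,r}$ for each $k\in\mathbb Z$, which maps cusp forms to cusp forms.
   Context: Setting. $F$ is a global function field of prime characteristic with field of constants $\mathbb F_q$; $\infty$ is a fixed place of $F$ of degree $\delta$; $A\subset F$ is the ring of elements regular away from $\infty$; $|\cdot|$ is the absolute value at $\infty$ with $|\pi|=q^{-\delta}$ for a uniformiser $\pi$; $F_\infty$ is the completion of $F$, and $\mathbb C_\infty$ is the completion of an algebraic closure of $F_\infty$. $\mathcal J(A)$ is the group of nonzero fractional ideals of $A$ in $F$. A lattice is a finitely generated $A$-submodule $\Lambda\subset\mathbb C_\infty$ meeting every ball of finite radius in a finite set; its rank is its rank as a projective $A$-module. $\mathcal L^r$, $\mathcal L^{\le r}$ are the sets of lattices of rank $r$, of rank $\le r$. $\mathcal L^{\le r}$ has the metric $\mathrm d_{\mathcal L}(\Lambda_1,\Lambda_2)=\sup_{|z|\le1}|e_{\Lambda_1}(z)-e_{\Lambda_2}(z)|$, where $e_\Lambda(z)=z\prod_{0\ne\lambda\in\Lambda}(1-z/\lambda)$. $\Psi^r\subset\mathbb C_\infty^r$ is the set of row vectors with $F_\infty$-linearly independent entries, with the rigid analytic structure of $\Omega^r\times\mathbb C_\infty^\times$ via $\psi\mapsto([\psi],\psi_r)$, $\Omega^r$ being the Drinfeld period domain. A function $f$ on $\mathcal L^r$ is holomorphic if for every finitely generated $A$-submodule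 $Y$ of rank $r$ of the space of column vectors $F^r$, the function $\psi\mapsto f(\psi Y)$ is holomorphic on $\Psi^r$. $\mathbf{Strong}^{k,r}$ is the $\mathbb C_\infty$-space of functions $f:\mathcal L^{\le r}\to\mathbb C_\infty$ that are continuous, homogeneous of degree $-k$ ($f(t\Lambda)=t^{-k}f(\Lambda)$ for $t\in\mathbb C_\infty^\times$), and holomorphic on $\mathcal L^r$. Cusp forms are those vanishing on $\mathcal L^{\le r-1}$. *)

(* Defs.v *)
From HB Require Import structures.
From mathcomp Require Import all_boot all_order all_algebra all_field.
From mathcomp Require Import boolp classical_sets functions cardinality fsbigop.
From mathcomp Require Import reals ereal.
(* Not imported: the notations of mpoly clash with those of MathComp-Analysis. *)
From mathcomp Require mpoly.

Set Implicit Arguments.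
Unset Strict Implicit.
Unset Printing Implicit Defensive.

Import Order.TTheory GRing.Theory Num.Theory.
Local Open Scope classical_set_scope.
Local Open Scope ring_scope.

(* A global function field is a finite extension F of a rational function     *)
(* field K(t), K finite. The choice of t plays no role below: only the image  *)
(* of K in F is used.                                                         *)
Section FunctionField.
Variables (K : finFieldType) (F : fieldExtType {fraction {poly K}}).

Definition cst (a : K) : F := (FracField.tofrac (a%:P))%:A.

Definition full_constant_field : Prop :=
  forall x : F, algebraicOver cst x -> exists a : K, x = cst a.

(* Places are encoded as normalised discrete valuations. The valuation of 0   *)
(* should be +oo; it is set to 0 so that distinct functions are distinct      *)
(* places, and "0 <= v x" still means that x is regular.                      *)
Record place (v : F -> int) : Prop := Place {
  place0 : v 0 = 0;
  placeM : forall x y, x != 0 -> y != 0 -> v (x * y) = v x + v y;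
  placeD : forall x y, x != 0 -> y != 0 -> x + y != 0 ->
             Order.min (v x) (v y) <= v (x + y);
  place_normalised : exists2 x, x != 0 & v x = 1 }.

(* The residue classes of the b i form a K-basis of the residue field.        *)
Definition place_degree (v : F -> int) (delta : nat) : Prop :=
  exists b : 'I_delta -> F, (forall i, 0 <= v (b i)) /\
    forall x, 0 <= v x -> exists! c : {ffun 'I_delta -> K},
      let y := x - \sum_i cst (c i) * b i in y = 0 \/ 0 < v y.

Definition regular_away (oo : F -> int) : set F :=
  [set a | forall w, place w -> w <> oo -> 0 <= w a].

Definition place_abs (R : realType) (oo : F -> int) (delta : nat) (x : F) : R :=
  if x == 0 then 0 else (#|K|%:R : R) ^ (- (delta%:Z * oo x)).

End FunctionField.

(* Submodules of an F-vector space V whose scalar multiplication is act, over *)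
(* a subring A of F with fraction field F.                                    *)
Section Submodules.
Variables (F : fieldType) (A : set F) (V : zmodType) (act : F -> V -> V).

Definition fg_submodule (M : set V) : Prop :=
  exists (n : nat) (g : 'I_n -> V),
    M = [set m | exists a : 'I_n -> F,
                   (forall i, A (a i)) /\ m = \sum_i act (a i) (g i)].

(* The rank of M is the F-dimension of M (x)_A F, which, M being torsion      *)
(* free, is the span of M in V.                                               *)
Definition has_rank (M : set V) (n : nat) : Prop :=
  exists b : 'I_n -> V,
    [/\ forall i, M (b i),
        forall c : 'I_n -> F, \sum_i act (c i) (b i) = 0 -> forall i, c i = 0
      & forall m, M m -> exists c : 'I_n -> F, m = \sum_i act (c i) (b i)].

Definition module_prod (I : set F) (M : set V) : set V :=
  [set m | exists (n : nat) (x : 'I_n -> F) (y : 'I_n -> V),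
     [/\ forall i, I (x i), forall i, M (y i) & m = \sum_i act (x i) (y i)]].

End Submodules.

Section FractionalIdeals.
Variables (F : fieldType) (A : set F).

Definition fractional_ideal (J : set F) : Prop :=
  fg_submodule A *%R J /\ exists2 x, J x & x != 0.

Definition ideal_mul (I J : set F) : set F := module_prod *%R I J.

(* A being a Dedekind domain, this is the inverse of J in the group of        *)
(* fractional ideals.                                                         *)
Definition ideal_inv (J : set F) : set F :=
  [set x | forall y, J y -> A (x * y)].

End FractionalIdeals.

Section Valued.
Variables (R : realType) (F C : fieldType) (iota : F -> C) (abs : C -> R).

Definition converges (u : nat -> C) (l : C) : Prop :=
  forall eps : R, 0 < eps ->
    exists N : nat, forall n, (N <= n)%N -> abs (u n - l) < eps.

Definition cauchy_seq (u : nat -> C) : Prop :=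
  forall eps : R, 0 < eps ->
    exists N : nat, forall m n, (N <= m)%N -> (N <= n)%N ->
      abs (u m - u n) < eps.

Definition closure_in (S : set C) : set C :=
  [set z | forall eps : R, 0 < eps -> exists2 x, S x & abs (z - x) < eps].

Definition Finf : set C := closure_in (range iota).

Definition Fbar : set C :=
  [set z | exists p : {poly C}, [/\ p != 0, forall i, Finf p`_i & root p z]].

(* (C, abs) is a completion of an algebraic closure of the completion of F    *)
(* with respect to absF. In a complete C, the completion of F is its closure  *)
(* Finf, and Fbar is the relative algebraic closure of Finf.                  *)
Record is_Cinf (absF : F -> R) : Prop := IsCinf {
  abs_eq0 : forall z, abs z = 0 <-> z = 0;
  abs_mul : forall z w, abs (z * w) = abs z * abs w;
  abs_ultra : forall z w, abs (z + w) <= Num.max (abs z) (abs w);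
  abs_iota : forall x, abs (iota x) = absF x;
  abs_complete : forall u, cauchy_seq u -> exists l, converges u l;
  Fbar_closed : forall p : {poly C}, (1 < size p)%N ->
    (forall i, Fbar p`_i) -> exists2 z, Fbar z & root p z;
  Fbar_dense : closure_in Fbar = setT }.

End Valued.

Section Lattices.
Variables (R : realType) (F : fieldType) (A : set F).
Variables (C : fieldType) (iota : F -> C) (abs : C -> R).

Definition iota_act (x : F) (z : C) : C := iota x * z.

Definition lattice (L : set C) : Prop :=
  fg_submodule A iota_act L /\
  forall rho : R, finite_set (L `&` [set z | abs z <= rho]).

Definition lattices (r : nat) : set (set C) :=
  [set L | lattice L /\ has_rank iota_act L r].

Definition lattices_le (r : nat) : set (set C) :=
  [set L | exists2 s, (s <= r)%N & lattices s L].

Definition lattice_exp_partial (L : set C) (z : C) (n : nat) : C :=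
  z * \big[*%R/1]_(l \in [set l | [/\ L l, l != 0 & abs l <= n%:R]]) (1 - z / l).

(* e_L(z): the infinite product is the limit of its partial products over     *)
(* the balls of radius n.                                                     *)
Definition lattice_exp (L : set C) (z : C) : C :=
  xget 0 [set w | converges abs (lattice_exp_partial L z) w].

(* The supremum is taken in \bar R, avoiding the junk value of sup on         *)
(* unbounded sets; it is finite for lattices.                                 *)
Definition lattice_dist (L1 L2 : set C) : \bar R :=
  ereal_sup [set (abs (lattice_exp L1 z - lattice_exp L2 z))%:E
            | z in [set z | abs z <= 1]].

Definition lattice_scale (t : C) (L : set C) : set C := [set t * z | z in L].

Definition ideal_lattice (I : set F) (L : set C) : set C :=
  module_prod iota_act I L.

End Lattices.

Section PeriodDomain.
Variables (R : realType) (K : finFieldType) (delta : nat).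
Variables (F C : fieldType) (iota : F -> C) (abs : C -> R) (r : nat).

Definition Psi : set 'rV[C]_r :=
  [set psi | forall h : 'I_r -> C, (forall i, Finf iota abs (h i)) ->
     \sum_i h i * psi 0 i = 0 -> forall i, h i = 0].

(* The affinoid Omega_n x {|pi|^n <= |s| <= |pi|^-n} in Omega^r x C^*, seen   *)
(* in Psi via psi |-> ([psi], psi_r), where Omega_n consists of the [psi]     *)
(* with |h psi| >= |pi|^n max_i |h_i| max_j |psi_j| for all h in Finf^r.      *)
(* These affinoids form the admissible covering defining the rigid analytic   *)
(* structure.                                                                 *)
Definition Psi_aff (n : nat) : set 'rV[C]_r :=
  [set psi | [/\ Psi psi,
     forall h : 'I_r -> C, (forall i, Finf iota abs (h i)) ->
       forall i j, (#|K|%:R : R) ^- (delta * n) * (abs (h i) * abs (psi 0 j))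
                   <= abs (\sum_l h l * psi 0 l)
   & forall i : 'I_r, i.+1 = r ->
       (#|K|%:R : R) ^- (delta * n) <= abs (psi 0 i)
         <= (#|K|%:R : R) ^+ (delta * n)]].

(* On each of these affinoids, the sections of the structure sheaf are the    *)
(* uniform limits of rational functions without poles there.                  *)
Definition holomorphic_Psi (g : 'rV[C]_r -> C) : Prop :=
  forall (n : nat) (eps : R), 0 < eps ->
    exists P Q : mpoly.mpoly r C, forall psi, Psi_aff n psi ->
      mpoly.meval (fun i => psi 0 i) Q != 0 /\
      abs (g psi - mpoly.meval (fun i => psi 0 i) P
                   / mpoly.meval (fun i => psi 0 i) Q) < eps.

End PeriodDomain.

(* Functions on the set of lattices of rank <= r are represented by functions *)
(* on all subsets of C; their values elsewhere are irrelevant, and equality   *)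
(* is equality on lattices_le r.                                              *)
Section StrongForms.
Variables (R : realType) (K : finFieldType) (delta : nat).
Variables (F : fieldType) (A : set F).
Variables (C : fieldType) (iota : F -> C) (abs : C -> R).
Variables (k : int) (r : nat).

Definition lattice_continuous (f : set C -> C) : Prop :=
  forall L, lattices_le A iota abs r L -> forall eps : R, 0 < eps ->
    exists2 d : R, 0 < d & forall L', lattices_le A iota abs r L' ->
      (lattice_dist abs L L' < d%:E)%E -> abs (f L - f L') < eps.

Definition lattice_homogeneous (f : set C -> C) : Prop :=
  forall L, lattices_le A iota abs r L -> forall t : C, t != 0 ->
    f (lattice_scale t L) = t ^ (- k) * f L.

Definition period_lattice (psi : 'rV[C]_r) (Y : set 'cV[F]_r) : set C :=
  [set \sum_i psi 0 i * iota (y i 0) | y in Y].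

Definition lattice_holomorphic (f : set C -> C) : Prop :=
  forall Y : set 'cV[F]_r,
    fg_submodule A *:%R Y -> has_rank *:%R Y r ->
    holomorphic_Psi K delta iota abs (fun psi => f (period_lattice psi Y)).

Record strong_form (f : set C -> C) : Prop := StrongForm {
  strong_continuous : lattice_continuous f;
  strong_homogeneous : lattice_homogeneous f;
  strong_holomorphic : lattice_holomorphic f }.

Definition cusp_form (f : set C -> C) : Prop :=
  strong_form f /\ forall L, lattices_le A iota abs r.-1 L -> f L = 0.

Definition slash (J : set F) (f : set C -> C) : set C -> C :=
  fun L => f (ideal_lattice iota (ideal_inv A J) L).

End StrongForms.

(* Main.v *)
Require Import Defs.
From HB Require Import structures.
From mathcomp Require Import all_boot all_order all_algebra all_field.
From mathcomp Require Import boolp classical_sets functions cardinality fsbigop.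
From mathcomp Require Import reals ereal filter.
From mathcomp Require Import zify lra ring.

Set Implicit Arguments.
Unset Strict Implicit.
Unset Printing Implicit Defensive.

Import Order.TTheory GRing.Theory Num.Theory.
Local Open Scope classical_set_scope.
Local Open Scope ring_scope.

(** Everything rests on two facts about the ring A of functions regular away
    from oo: fractional ideals are invertible, and multiplication by a fractional
    ideal I, as a map from lattices of rank <= r to themselves, is continuous.

    Invertibility. The field F has finite degree over K(y) for every
    transcendental y; this is obtained by counting polynomial combinations over
    the finite field K ([bounded_dependence]) and is used throughout in the
    following form: elements of a K[y]-module which are K-independent modulo y
    are K[y]-independent ([indep_mod_free]), so the quotient modulo y is finite.
    A count of Riemann's type, together with weak approximation, produces a
    transcendental element of A ([regular_transcendental]); hence every element
    of F has a denominator in A, and every proper quotient A/dA is finite. As A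
    is also completely integrally closed, being an intersection of discrete
    valuation rings, the classical argument of Dedekind theory applies: a proper
    ideal is multiplied into A by some x outside A ([proper_ideal_colon]), and
    for the ideal J J^-1 this is absurd ([ideal_inv_mul]). It follows that v lies
    in J^-1 L if and only if y v lies in L for all y in J. This description
    gives the group laws, and finite generation of J^-1 shows that J^-1 L is a
    lattice of the same rank and that J^-1 commutes with the formation of period
    lattices, so that holomorphy is preserved.

    Continuity. The metric compares exponential functions on the unit disc only.
    Let a in A have absolute value > 1. For a lattice of rank <= r, the quotient
    L / a L has at most N elements, N depending on a and r alone, so that
    e_L(a z) is a polynomial of degree <= N in e_L(z) ([lprod_functional]).
    Lagrange interpolation recovers this polynomial from finitely many values of
    e_L in the unit disc, and therefore closeness on the unit disc implies
    closeness on all discs ([uniformly_close_all]). Since the distance from z to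
    L is at most |e_L(z)| ([lattice_exp_dist]), lattices with close exponential
    functions are close as point sets in large balls. This is inherited by
    multiples by I: if 1 is the sum of the x_k y_k with x_k in I and y_k in I^-1,
    then l is the sum of the x_k (y_k l), and each y_k l is a point of L
    ([close_in_ideal]). Conversely, closeness in a large ball makes exponential
    functions close on the unit disc, by comparing products factor by factor
    ([close_in_exp]). *)

(** * Linear dependence over polynomial rings *)

Section PolynomialDependence.
Variables (K E : fieldType) (c : {rmorphism K -> E}).

Definition pev (y : E) (p : {poly K}) : E := (map_poly c p).[y].

HB.instance Definition _ y :=
  GRing.RMorphism.copy (pev y) (horner_eval y \o map_poly c).

Lemma pevC y a : pev y a%:P = c a.
Proof. by rewrite /pev map_polyC hornerC. Qed.

Lemma pevX y : pev y 'X = y.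
Proof. by rewrite /pev map_polyX hornerX. Qed.

Lemma pevE y n (p : {poly K}) : (size p <= n)%N -> pev y p = \sum_(i < n) c p`_i * y ^+ i.
Proof.
move=> sp; rewrite /pev (horner_coef_wide _ (n := n)).
  by apply: eq_bigr => i _; rewrite coef_map.
by rewrite size_map_poly.
Qed.

Lemma pev_split y (p : {poly K}) : pev y p = c p`_0 + pev y (drop_poly 1 p) * y.
Proof.
rewrite -[in LHS](poly_take_drop 1 p) expr1 rmorphD rmorphM /= pevX -(pevC y).
congr (pev _ _ + _).
by apply/polyP => -[|i]; rewrite coef_take_poly coefC.
Qed.

Definition poly_dependent (y : E) N (f : 'I_N -> E) : Prop :=
  exists p : 'I_N -> {poly K},
    (exists i, p i != 0) /\ \sum_i pev y (p i) * f i = 0.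

Definition transcendental (y : E) : Prop := forall p, p != 0 -> pev y p != 0.

(** All that is used of a function field over its constants: E has finite degree
    n over K(y), for every transcendental y. Vectors with s coordinates are
    allowed in order to bound the rank over K[y] of lattices of rank s. *)
Definition bounded_dependent : Prop := forall y : E, exists n : nat,
  forall s N (f : 'I_N -> 'I_s -> E), (n * s < N)%N ->
  exists p : 'I_N -> {poly K}, (exists i, p i != 0) /\
    forall k, \sum_i pev y (p i) * f i k = 0.

End PolynomialDependence.

Lemma pigeonhole (U V : finType) (h : U -> V) :
  (#|V| < #|U|)%N -> exists u v, u != v /\ h u = h v.
Proof.
move=> lt; apply: contrapT => nex.
suff /leq_card : injective h by rewrite leqNgt lt.
move=> u v huv; apply/eqP/negPn/negP => uv; apply: nex.
by exists u, v.
Qed.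

(** Stripping common factors of a polynomial relation: one of the coefficients
    has a nonzero constant term, so that reducing modulo the variable loses
    no information. *)
Lemma poly_family_split (K : fieldType) N (p : 'I_N -> {poly K}) :
  exists (e : nat) (q : 'I_N -> {poly K}),
    (forall i, p i = q i * 'X^e) /\ ((exists i, p i != 0) -> exists i, (q i)`_0 != 0).
Proof.
have [m] := ubnP (\sum_i size (p i))%N.
elim: m p => // m IH p; rewrite ltnS => lt.
have [[i0 pi0]|nz] := pselect (exists i, (p i)`_0 != 0).
  by exists 0%N, p; split=> [i|_]; [rewrite expr0 mulr1|exists i0].
have z i : (p i)`_0 = 0 by apply/eqP/negPn/negP => h; apply: nz; exists i.
have [all0|] := pselect (forall i, p i = 0).
  by exists 0%N, p; split=> [i|[i]]; rewrite ?expr0 ?mulr1 // all0 eqxx.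
move=> /existsNP[i0 /eqP pi0].
pose p' i := drop_poly 1 (p i).
have pE i : p i = p' i * 'X.
  rewrite -[LHS](poly_take_drop 1) expr1 [take_poly _ _]size1_polyC.
    by rewrite coef_take_poly /= z polyC0 add0r.
  exact: size_take_poly.
have lt' : (\sum_i size (p' i) < m)%N.
  apply: leq_trans lt; rewrite (bigD1 i0) //= [leqRHS](bigD1 i0) //=.
  rewrite -addSn leq_add //; last first.
    by apply: leq_sum => i _; rewrite size_drop_poly leq_subr.
  by rewrite size_drop_poly ltn_subrL /= size_poly_gt0.
have [e [q [qE q0]]] := IH p' lt'.
exists e.+1, q; split=> [i|_]; first by rewrite pE qE exprSr mulrA.
apply: q0; exists i0; apply: contra_neq pi0 => h.
by rewrite pE h mul0r.
Qed.

Section FunctionFieldCounting.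
Variables (K : finFieldType) (F : fieldExtType {fraction {poly K}}).

Definition polyF (p : {poly K}) : F := (FracField.tofrac p)%:A.

HB.instance Definition _ :=
  GRing.RMorphism.copy polyF (in_alg F \o @FracField.tofrac {poly K}).

Fact cst_is_zmod_morphism : zmod_morphism (@Defs.cst K F).
Proof. exact: (rmorphB (polyF \o polyC)). Qed.

Fact cst_is_monoid_morphism : monoid_morphism (@Defs.cst K F).
Proof.
by split=> [|a b]; [exact: (rmorph1 (polyF \o polyC))|exact: (rmorphM (polyF \o polyC))].
Qed.

HB.instance Definition _ :=
  GRing.isZmodMorphism.Build K F (@Defs.cst K F) cst_is_zmod_morphism.
HB.instance Definition _ :=
  GRing.isMonoidMorphism.Build K F (@Defs.cst K F) cst_is_monoid_morphism.

Lemma polyF_eq0 p : (polyF p == 0) = (p == 0).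
Proof. by rewrite /polyF scaler_eq0 oner_eq0 orbF tofrac_eq0. Qed.

Let D := \dim {: F}.
Let e (j : 'I_D) : F := (vbasis {: F})`_j.

(** Vectors with polynomial coordinates of bounded degree form a finite set, of
    size exponential in the degree bound. *)
Definition box (S : nat) (x : F) : Prop := exists g : 'I_D -> {poly K},
  (forall j, size (g j) <= S)%N /\ x = \sum_j polyF (g j) * e j.

Lemma box_le S S' x : (S <= S')%N -> box S x -> box S' x.
Proof.
by move=> le [g [sg ->]]; exists g; split=> // j; exact: leq_trans (sg j) le.
Qed.

Lemma box0 S : box S 0.
Proof.
exists (fun=> 0); split=> [j|]; first by rewrite size_poly0.
by rewrite big1 // => j _; rewrite rmorph0 mul0r.
Qed.

Lemma boxD S x y : box S x -> box S y -> box S (x + y).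
Proof.
move=> [g [sg ->]] [h [sh ->]]; exists (fun j => g j + h j); split=> [j|].
  by rewrite (leq_trans (size_polyD _ _)) // geq_max sg sh.
by rewrite -big_split; apply: eq_bigr => j _; rewrite rmorphD mulrDl.
Qed.

Lemma box_sum S (I : Type) (r : seq I) (P : pred I) (f : I -> F) :
  (forall i, P i -> box S (f i)) -> box S (\sum_(i <- r | P i) f i).
Proof. by move=> h; apply: big_ind => //; [exact: box0|exact: boxD]. Qed.

Lemma boxM S (p : {poly K}) x : box S x -> box (S + size p) (polyF p * x).
Proof.
move=> [g [sg ->]]; exists (fun j => p * g j); split=> [j|].
  rewrite (leq_trans (size_polyMleq _ _)) //.
  by apply: leq_trans (leq_pred _) _; rewrite addnC leq_add2r.
by rewrite mulr_sumr; apply: eq_bigr => j _; rewrite rmorphM mulrA.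
Qed.

Lemma boxZ S a x : box S x -> box S (Defs.cst F a * x).
Proof.
move=> [g [sg ->]]; exists (fun j => a%:P * g j); split=> [j|].
  by rewrite mul_polyC (leq_trans (size_scale_leq _ _)).
by rewrite mulr_sumr; apply: eq_bigr => j _; rewrite rmorphM mulrA.
Qed.

Lemma frac_denom (x : {fraction {poly K}}) :
  exists2 d : {poly K}, d != 0 &
    exists n : {poly K}, FracField.tofrac d * x = FracField.tofrac n.
Proof.
elim/quotW: x => r; exists r.2; first exact: denom_ratioP.
exists r.1; unlock FracField.tofrac; rewrite -[LHS]FracField.pi_mul.
apply/eqmodP; rewrite /= FracField.equivfE /FracField.mulf.
rewrite !numden_Ratio ?oner_eq0 ?mulr1 ?mul1r ?mulf_neq0 ?oner_eq0 ?denom_ratioP //.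
Qed.

Lemma denominator (x : F) : exists2 Q : {poly K}, Q != 0 &
  exists S, box S (polyF Q * x).
Proof.
have memx : x \in {: F}%VS by rewrite memvf.
pose a j := coord (vbasis {: F}) j x.
have [d d0 hd] : exists2 d : 'I_D -> {poly K}, (forall j, d j != 0) &
    forall j, exists n, FracField.tofrac (d j) * a j = FracField.tofrac n.
  have /choice[d hd] j : exists d, d != 0 /\
      exists n, FracField.tofrac d * a j = FracField.tofrac n.
    by have [d d0 hn] := frac_denom (a j); exists d.
  by exists d => j; have [] := hd j.
have /choice[n hn] := hd.
exists (\prod_j d j); first by apply/prodf_neq0 => j _.
pose g j := n j * \prod_(i | i != j) d i.
exists (\max_j size (g j)), g; split=> [j|]; first exact: leq_bigmax.
rewrite [in LHS](coord_vbasis memx) mulr_sumr; apply: eq_bigr => j _.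
rewrite (bigD1 j) //= -/(a j) /e /g -scalerAr scalerAl; congr (_ * _).
rewrite !rmorphM /= scalerAl; congr (_ * _).
by rewrite /polyF scalerA mulrC hn.
Qed.

Lemma common_denominator (I : finType) (x : I -> F) :
  exists2 Q : {poly K}, Q != 0 & exists S, forall i, box S (polyF Q * x i).
Proof.
have /choice[Q hQ] i : exists Q, Q != 0 /\ exists S, box S (polyF Q * x i).
  by have [Q Q0 hS] := denominator (x i); exists Q.
have /choice[S hS] i : exists S, box S (polyF (Q i) * x i) by have [] := hQ i.
exists (\prod_i Q i); first by apply/prodf_neq0 => i _; have [] := hQ i.
exists (\max_i (S i + size (\prod_(j | j != i) Q j)%R)%N) => i.
apply: (@box_le (S i + size (\prod_(j | j != i) Q j))).
  exact: (leq_bigmax i).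
rewrite [X in polyF X](bigD1 i) //= rmorphM /= mulrAC mulrC; exact: boxM.
Qed.

(** Multiplication by y raises the degree bound of a box by some c, up to a
    denominator. So among the |K|^(N M) combinations of N vectors with
    coefficients of degree < M in y, all of which lie in a box with about
    |K|^(D c s M) elements, two coincide as soon as N > D c s and M is large. *)
Lemma bounded_dependence : bounded_dependent (@Defs.cst K F).
Proof.
move=> y; have [Q Q0 [c0 hc0]] := common_denominator (fun j => y * e j).
pose c := (c0 + size Q)%N.
have boxQ S x : box S x -> box (S + c) (polyF Q * x).
  by move=> /(boxM Q); apply: box_le; rewrite leq_add2l leq_addl.
have boxy S x : box S x -> box (S + c) (polyF Q * y * x).
  move=> [g [sg ->]]; rewrite mulr_sumr; apply: box_sum => j _.
  rewrite mulrCA -mulrA; apply: (@box_le (c0 + size (g j))).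
    by have := sg j; rewrite /c; lia.
  exact/boxM/hc0.
have boxyi M i S x : (i <= M)%N -> box S x ->
    box (S + c * M) (polyF (Q ^+ M) * y ^+ i * x).
  move=> + bx; elim: M i => [|M IH] [|i] // le.
  - by rewrite muln0 addn0 !expr0 rmorph1 !mul1r.
  - rewrite exprS rmorphM /= -!mulrA mulnS addnCA addnC; apply: boxQ.
    by rewrite mulrA; apply: IH.
  rewrite !exprS rmorphM /= [X in X * x]mulrACA -[X in box _ X]mulrA.
  by rewrite mulnS addnCA addnC; apply: boxy; apply: IH.
exists (D * c)%N => s N f lt.
have [Qf Qf0 [S hS]] := common_denominator (fun ik : 'I_N * 'I_s => f ik.1 ik.2).
pose M := (s * D * S).+1; pose T := (S + c * M)%N.
pose G (u : 'M[K]_(N, M)) k :=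
  \sum_i pev (@Defs.cst K F) y (rVpoly (row i u)) * f i k.
have boxG u k : box T (polyF (Q ^+ M) * polyF Qf * G u k).
  rewrite mulr_sumr; apply: box_sum => i _.
  rewrite (@pevE _ _ _ y M) ?size_poly // mulr_suml mulr_sumr.
  apply: box_sum => l _.
  have -> : polyF (Q ^+ M) * polyF Qf *
      (Defs.cst F (rVpoly (row i u))`_l * y ^+ l * f i k) =
    Defs.cst F (rVpoly (row i u))`_l *
      (polyF (Q ^+ M) * y ^+ l * (polyF Qf * f i k)).
    by rewrite mulrACA (mulrCA _ (Defs.cst F _)) -!mulrA.
  apply/boxZ/boxyi; first exact: ltnW.
  exact: (hS (i, k)).
have /choice[h hh] u : exists h : {ffun 'I_s * 'I_D -> 'rV[K]_T}, forall k,
    polyF (Q ^+ M) * polyF Qf * G u k = \sum_j polyF (rVpoly (h (k, j))) * e j.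
  have /choice[g hg] k := boxG u k.
  exists [ffun kj => poly_rV (g kj.1 kj.2)] => k; have [sg ->] := hg k.
  by apply: eq_bigr => j _; rewrite ffunE poly_rV_K.
have [|u [v [uv huv]]] := @pigeonhole _ _ h.
  rewrite card_ffun !card_mx card_prod !card_ord -expnM ltn_exp2l ?finRing_gt1 //.
  have : (D * c * s * M + M <= N * M)%N by rewrite addnC -mulSn leq_mul2r lt orbT.
  by apply: leq_trans; rewrite /M /T; nia.
exists (fun i => rVpoly (row i (u - v))); split.
  apply: contrapT => /forallNP z; move/eqP: uv; apply.
  apply/row_matrixP => i; apply/eqP; rewrite -subr_eq0 -linearB /=.
  rewrite -[X in X == 0]rVpolyK; have /negP/negPn/eqP -> := z i.
  by rewrite linear0.
move=> k; apply/eqP.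
have nz : polyF (Q ^+ M) * polyF Qf != 0 by rewrite mulf_neq0 ?polyF_eq0 ?expf_neq0.
rewrite -(mulrI_eq0 _ (mulfI nz)); apply/eqP.
transitivity (polyF (Q ^+ M) * polyF Qf * (G u k - G v k)).
  congr (_ * _); rewrite /G -sumrB; apply: eq_bigr => i _.
  by rewrite !linearB rmorphB mulrBl.
by rewrite mulrBr !hh huv subrr.
Qed.

End FunctionFieldCounting.

(** * Places *)

Section Valuations.
Variables (K : finFieldType) (F : fieldType) (c : {rmorphism K -> F}).
Implicit Types (v w : F -> int) (x y z : F).

(** Places, freed from the presentation of the field as an extension of K(t). *)
Record valuation v : Prop := Valuation {
  val0 : v 0 = 0;
  valM : forall x y, x != 0 -> y != 0 -> v (x * y) = v x + v y;
  valD : forall x y, x != 0 -> y != 0 -> x + y != 0 ->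
             Order.min (v x) (v y) <= v (x + y);
  val_normalised : exists2 x, x != 0 & v x = 1 }.

Local Notation ev := (pev c).

(** The valuation of 0 being a dummy 0, bounds from below on valuations are
    stated with this predicate, which is closed under addition. *)
Definition vge v (k : int) x : Prop := x = 0 \/ k <= v x.

Section OneValuation.
Variables (v : F -> int) (pv : valuation v).

Lemma val1 : v 1 = 0.
Proof. by apply: (addrI (v 1)); rewrite addr0 -(valM pv) ?oner_neq0 // mulr1. Qed.

Lemma valV x : v x^-1 = - v x.
Proof.
have [->|x0] := eqVneq x 0; first by rewrite invr0 (val0 pv).
have := valM pv x0 (_ : x^-1 != 0); rewrite divff // val1 invr_eq0.
by move=> /(_ x0)/esym/eqP; rewrite addrC addr_eq0 => /eqP.
Qed.

Lemma valX x n : v (x ^+ n) = v x *+ n.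
Proof.
have [->|x0] := eqVneq x 0.
  by rewrite expr0n; case: n => [|n] /=; rewrite ?val1 (val0 pv) ?mul0rn.
elim: n => [|n IH]; first by rewrite expr0 val1.
by rewrite exprS (valM pv) ?expf_neq0 // IH mulrS.
Qed.

Lemma val_unity x n : (0 < n)%N -> x ^+ n = 1 -> v x = 0.
Proof. by move=> n0 /(congr1 v); rewrite valX val1 -mulr_natr; nia. Qed.

Lemma valN x : v (- x) = v x.
Proof.
have [->|x0] := eqVneq x 0; first by rewrite oppr0.
rewrite -mulN1r (valM pv) ?oppr_eq0 ?oner_neq0 //.
by rewrite (@val_unity (-1) 2) ?add0r // sqrrN expr1n.
Qed.

Lemma val_const a : v (c a) = 0.
Proof.
have [->|a0] := eqVneq a 0; first by rewrite rmorph0 (val0 pv).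
apply: (@val_unity _ #|K|.-1); first by rewrite -subn1 subn_gt0 finRing_gt1.
rewrite -rmorphXn /=; apply: etrans (rmorph1 c); congr (c _).
by apply: (mulfI a0); rewrite mulr1 -exprS prednK ?expf_card // ltnW ?finRing_gt1.
Qed.

Lemma vge0 k : vge v k 0. Proof. by left. Qed.

Lemma vge_0E x : vge v 0 x <-> 0 <= v x.
Proof. by split=> [[->|//]|]; [rewrite (val0 pv)|right]. Qed.

Lemma vge_le k l x : k <= l -> vge v l x -> vge v k x.
Proof. by move=> kl [|]; [left|right; apply: le_trans kl _]. Qed.

Lemma vgeD k x y : vge v k x -> vge v k y -> vge v k (x + y).
Proof.
have [->|x0] := eqVneq x 0; first by rewrite add0r.
have [->|y0] := eqVneq y 0; first by rewrite addr0.
have [->|xy0] := eqVneq (x + y) 0; first by left.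
case=> [/eqP|kx]; first by rewrite (negPf x0).
case=> [/eqP|ky]; [by rewrite (negPf y0)|right].
by apply: le_trans (valD pv x0 y0 xy0); rewrite le_min kx ky.
Qed.

Lemma vgeM k l x y : vge v k x -> vge v l y -> vge v (k + l) (x * y).
Proof.
have [->|x0] := eqVneq x 0; first by rewrite mul0r; left.
have [->|y0] := eqVneq y 0; first by rewrite mulr0; left.
case=> [/eqP|kx]; first by rewrite (negPf x0).
case=> [/eqP|ky]; [by rewrite (negPf y0)|right].
by rewrite (valM pv) // lerD.
Qed.

Lemma vge_sum k (I : Type) (r : seq I) (P : pred I) (f : I -> F) :
  (forall i, P i -> vge v k (f i)) -> vge v k (\sum_(i <- r | P i) f i).
Proof. by move=> h; apply: big_ind => //; [exact: vge0|exact: vgeD]. Qed.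

Lemma val_ge0D x y : 0 <= v x -> 0 <= v y -> 0 <= v (x + y).
Proof. by rewrite -!vge_0E; exact: vgeD. Qed.

Lemma val_ge0M x y : 0 <= v x -> 0 <= v y -> 0 <= v (x * y).
Proof. by rewrite -!vge_0E => hx hy; have := vgeM hx hy; rewrite addr0. Qed.

(** The strong triangle inequality is an equality when one term dominates. *)
Lemma val_domin x y : x != 0 -> vge v (v x + 1) y ->
  x + y != 0 /\ v (x + y) = v x.
Proof.
move=> x0 [->|h]; first by rewrite addr0.
have [y0|y0] := eqVneq y 0; first by rewrite y0 addr0.
have xy0 : x + y != 0.
  apply/eqP => /(canRL (addrK _)); rewrite add0r => xE.
  by move: h; rewrite xE valN; lia.
split=> //; apply/eqP; rewrite eq_le; apply/andP; split; last first.
  by apply: le_trans (valD pv x0 y0 xy0); rewrite le_min lexx; lia.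
have := valD pv xy0 (_ : - y != 0); rewrite addrK oppr_eq0 valN ge_min.
by move=> /(_ y0 x0) /orP[//|]; lia.
Qed.

Lemma val_sum0 N (f : 'I_N -> F) i0 :
  (forall i, i != i0 -> vge v (v (f i0) + 1) (f i)) -> \sum_i f i = 0 -> f i0 = 0.
Proof.
move=> h; rewrite (bigD1 i0) //= => s0; apply/eqP/negPn/negP => f0.
have [] : _ /\ _ := val_domin f0 (vge_sum (index_enum 'I_N) (P := predC1 i0) h).
by rewrite s0 eqxx.
Qed.

Lemma ev_ge0 y (p : {poly K}) : 0 <= v y -> 0 <= v (ev y p).
Proof.
move=> vy; rewrite (pevE _ _ (leqnn _)); apply/vge_0E/vge_sum => i _.
by apply/vge_0E/val_ge0M; rewrite ?val_const // valX mulrn_wge0.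
Qed.

Lemma ev_unit y (p : {poly K}) : 0 < v y -> p`_0 != 0 -> ev y p != 0 /\ v (ev y p) = 0.
Proof.
move=> vy p0; rewrite pev_split; set a := c _.
have a0 : a != 0 by rewrite fmorph_eq0.
have [] // := val_domin a0 (_ : vge v _ (ev y (drop_poly 1 p) * y)).
  rewrite val_const add0r; apply: (@vge_le _ (0 + v y)); first by lia.
  by apply: vgeM; [apply/vge_0E/ev_ge0/ltW|right].
by rewrite val_const.
Qed.

(** After division by a power of y, a polynomial in y becomes a unit at v. *)
Lemma val_transcendental y : 0 < v y -> transcendental c y.
Proof.
move=> vy p p0; have [e [q [pE q0]]] := poly_family_split (fun _ : 'I_1 => p).
have [|i /(ev_unit vy)[nz _]] := q0; first by exists ord0.
rewrite (pE i) rmorphM rmorphXn /= pevX mulf_neq0 // expf_neq0 //.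
by apply: contraTneq vy => ->; rewrite (val0 pv).
Qed.

(** In an equation for x with coefficients regular at v, the leading term
    cannot be the only one of smallest valuation: its coefficient clears the
    pole of x. *)
Lemma val_integral n (a : 'I_n.+1 -> F) x : (forall i, 0 <= v (a i)) ->
  \sum_i a i * x ^+ i = 0 -> 0 <= v (a ord_max * x).
Proof.
move=> a_ge0 s0; have [->|x0] := eqVneq x 0; first by rewrite mulr0 (val0 pv).
have [->|an0] := eqVneq (a ord_max) 0; first by rewrite mul0r (val0 pv).
rewrite leNgt; apply/negP => lt; case/negP: (an0).
suff : a ord_max * x ^+ n = 0.
  by move=> /eqP; rewrite mulf_eq0 expf_eq0 (negPf x0) andbF orbF.
apply: (val_sum0 (f := fun i : 'I_n.+1 => a i * x ^+ i) (i0 := ord_max)) => //.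
move=> i i_n; have lt_in : (i < n)%N.
  by rewrite ltn_neqAle -ltnS ltn_ord andbT; apply: contra_neq i_n => h; exact/val_inj.
rewrite (valM pv) ?expf_neq0 // valX /=.
apply: (@vge_le _ (0 + v x *+ i)); last first.
  by apply: vgeM; [apply/vge_0E|right; rewrite valX].
have nE : v x *+ n = v x + v x *+ i + v x *+ (n - i.+1).
  by rewrite -mulrS -mulrnDr subnKC.
move: lt; rewrite (valM pv) // nE add0r => lt.
have X0 : v x *+ (n - i.+1) <= 0.
  by rewrite mulrn_wle0 //; move: lt (a_ge0 ord_max); lia.
by move: lt X0; lia.
Qed.
End OneValuation.
End Valuations.

(** * Approximation *)

Section Approximation.
Variables (K : finFieldType) (F : fieldType) (c : {rmorphism K -> F}).
Implicit Types (v w : F -> int) (x y z : F).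

Local Notation ev := (pev c).

Lemma val_units v w : valuation v -> valuation w ->
  (forall x, 0 <= w x -> 0 <= v x) -> forall x, w x = 0 -> v x = 0.
Proof.
move=> pv pw incl x wx; apply/eqP; rewrite eq_le incl ?wx // andbT.
by rewrite -oppr_ge0 -(valV pv) incl // (valV pw) wx.
Qed.

Lemma val_1D_gt0 v x : valuation v -> 0 < v x -> v (1 + x) = 0.
Proof.
move=> pv vx; have [|_] := val_domin pv (oner_neq0 F) (_ : vge v _ x).
  by right; rewrite (val1 pv); lia.
by rewrite (val1 pv).
Qed.

Lemma val_1D_lt0 v x : valuation v -> v x < 0 -> 1 + x != 0 /\ v (1 + x) = v x.
Proof.
move=> pv vx; rewrite addrC; apply: (val_domin pv).
  by apply: contraTneq vx => ->; rewrite (val0 pv).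
by right; rewrite (val1 pv); lia.
Qed.

(** Discrete valuation rings are maximal subrings: once the units of w are units
    of v, the valuation v is a multiple of w, and both are normalised. *)
Lemma val_ring_inj v w : valuation v -> valuation w ->
  (forall x, 0 <= w x -> 0 <= v x) -> v = w.
Proof.
move=> pv pw incl; have units := val_units pv pw incl.
have [p p0 wp] := val_normalised pw.
have vE x : x != 0 -> v x = v p * w x.
  move=> x0; case E : (w x) => [m|m].
    have u0 : v (x / p ^+ m) = 0.
      apply: units; rewrite (valM pw) ?invr_eq0 ?expf_neq0 // (valV pw) (valX pw) E wp.
      by rewrite natz subrr.
    move: u0; rewrite (valM pv) ?invr_eq0 ?expf_neq0 // (valV pv) (valX pv).
    by move/eqP; rewrite subr_eq0 => /eqP ->; rewrite -mulr_natr natz.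
  have u0 : v (x * p ^+ m.+1) = 0.
    apply: units; rewrite (valM pw) ?expf_neq0 // (valX pw) E wp.
    by rewrite NegzE natz addNr.
  move: u0; rewrite (valM pv) ?expf_neq0 // (valX pv).
  by move/eqP; rewrite addr_eq0 => /eqP ->; rewrite NegzE mulrN -mulr_natr natz.
have [t t0 vt] := val_normalised pv.
have vp : v p = 1.
  have : 0 <= v p by apply: incl; rewrite wp.
  move=> vp0; have := congr1 absz vt; rewrite vE // abszM => /eqP.
  by rewrite muln_eq1 => /andP[/eqP vp1 _]; rewrite -(gez0_abs vp0) vp1.
apply/funext => x; have [->|x0] := eqVneq x 0; first by rewrite (val0 pv) (val0 pw).
by rewrite vE // vp mul1r.
Qed.

Lemma val_separation v w : valuation v -> valuation w -> v <> w ->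
  exists u, v u < 0 /\ 0 < w u.
Proof.
have neg0 v' x : valuation v' -> v' x < 0 -> x != 0.
  by move=> pv'; apply: contraTneq => ->; rewrite (val0 pv').
have sep v' w' : valuation v' -> valuation w' -> v' <> w' ->
    exists z, v' z < 0 /\ 0 <= w' z.
  move=> pv pw vw; apply: contrapT => /forallNP h; apply: vw.
  apply: val_ring_inj => // x wx; rewrite leNgt; apply/negP => vx.
  by apply: (h x).
move=> pv pw vw; have [z [vz wz]] := sep _ _ pv pw vw.
have [t [wt vt]] := sep _ _ pw pv (nesym vw).
have z0 := neg0 _ _ pv vz; have t0 := neg0 _ _ pw wt.
exists (z / t); rewrite (valM pv) ?(valM pw) ?invr_eq0 // (valV pv) (valV pw).
by split; lia.
Qed.

Lemma val_large_power (I : eqType) (W : I -> F -> int) (s : seq I) z u :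
  z != 0 -> u != 0 -> (forall i, i \in s -> valuation (W i)) ->
  (forall i, i \in s -> 0 < W i z) ->
  exists2 k, (0 < k)%N & forall i, i \in s -> 0 < W i (z ^+ k * u).
Proof.
move=> z0 u0 pW Wz; exists (\sum_(i <- s) `|W i u|).+1 => // i si.
have pWi := pW i si; rewrite (valM pWi) ?expf_neq0 // (valX pWi).
have : (`|W i u| <= \sum_(i <- s) `|W i u|)%N.
  by rewrite (big_rem i) //= leq_addr.
move: (\sum_(_ <- _) _)%N (Wz i si) => S; rewrite -mulr_natr natz.
by move: (W i u) (W i z) => a b; nia.
Qed.

(** An element with a pole at v and zeros at finitely many other places: given
    one, z, for all but the last place w, and one, u, for w alone, combine u
    with a high power of z, or of z / (1 + z) if z has a pole at w. *)
Lemma weak_approximation v (I : eqType) (W : I -> F -> int) (s : seq I) :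
  valuation v -> (forall i, i \in s -> valuation (W i) /\ W i <> v) ->
  exists z, v z < 0 /\ forall i, i \in s -> 0 < W i z.
Proof.
move=> pv; have neg0 x : v x < 0 -> x != 0.
  by apply: contraTneq => ->; rewrite (val0 pv).
elim: s => [|j s IH] Ws.
  have [p p0 vp] := val_normalised pv.
  by exists p^-1; split=> //; rewrite (valV pv) vp.
have [|z [vz Wz]] := IH; first by move=> i si; apply: Ws; rewrite inE si orbT.
have [pW Wv] := Ws j (mem_head _ _).
have [u [vu Wu]] := val_separation pv pW (nesym Wv).
have z0 := neg0 _ vz; have u0 := neg0 _ vu.
have pWs i : i \in s -> valuation (W i) by move=> si; have [] := Ws i; rewrite ?inE ?si ?orbT.
have [k k0 Wk] := val_large_power z0 u0 pWs Wz.
have vzk : v (z ^+ k) < 0 by rewrite (valX pv) pmulrn_llt0.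
have [Wjz|Wjz] := leP 0 (W j z).
  exists (z ^+ k * u); split.
    by rewrite (valM pv) ?expf_neq0 //; lia.
  move=> i; rewrite inE => /orP[/eqP ->|]; last exact: Wk.
  by rewrite (valM pW) ?expf_neq0 // (valX pW) ltr_wpDl // mulrn_wge0.
have [nz vE] := val_1D_lt0 pv vzk.
have Wjzk : W j (z ^+ k) < 0 by rewrite (valX pW) pmulrn_llt0.
have [_ WjE] := val_1D_lt0 pW Wjzk.
exists (z ^+ k * u / (1 + z ^+ k)); split.
  by rewrite !(valM pv) ?mulf_neq0 ?invr_eq0 ?expf_neq0 // (valV pv) vE; lia.
move=> i; rewrite inE => /orP[/eqP ->|si].
  by rewrite !(valM pW) ?mulf_neq0 ?invr_eq0 ?expf_neq0 // (valV pW) WjE; lia.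
have pWi := pWs _ si.
rewrite (valM pWi) ?mulf_neq0 ?invr_eq0 ?expf_neq0 // (valV pWi).
rewrite (val_1D_gt0 pWi) ?subr0 ?Wk // (valX pWi).
have := Wz _ si; move: (W i z) => a a0; rewrite -mulr_natr natz; nia.
Qed.

(** For each of the places W i let z i have a pole there and zeros at the others.
    The z i / (1 + z i) are 1 at W i and 0 at the others, hence independent
    over K(y). *)
Lemma few_zeros y n :
  (forall N (f : 'I_N -> F), (n < N)%N -> poly_dependent c y f) ->
  forall N (W : 'I_N -> F -> int), injective W ->
  (forall i, valuation (W i) /\ 0 < W i y) -> (N <= n)%N.
Proof.
move=> dep N W injW hW; rewrite leqNgt; apply/negP => /dep {}dep.
have pW i : valuation (W i) by have [] := hW i.
have /choice[z hz] i : exists z, W i z < 0 /\ forall j, j != i -> 0 < W j z.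
  have [|z [zi zj]] := @weak_approximation (W i) _ W (enum (predC1 i)) (pW i).
    by move=> j; rewrite mem_enum inE => ji; split=> // /injW /eqP; apply/negP.
  by exists z; split=> // j ji; apply: zj; rewrite mem_enum inE.
have z0 i : z i != 0.
  by have [+ _] := hz i; apply: contraTneq => ->; rewrite (val0 (pW i)).
have z1 i : 1 + z i != 0 /\ W i (1 + z i) = W i (z i).
  by have [zi _] := hz i; exact: val_1D_lt0.
have z2 i j : j != i -> W j (1 + z i) = 0.
  by move=> ji; have [_ /(_ j ji) zj] := hz i; exact: val_1D_gt0.
have [p [pn0 +]] := dep (fun i => z i / (1 + z i)).
have [e [q [pE /(_ pn0) [i q0]]]] := poly_family_split p.
have yi := proj2 (hW i).
have y0 : y != 0 by apply: contraTneq yi => ->; rewrite (val0 (pW i)).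
have [u0 vu] := ev_unit c (pW i) yi q0.
rewrite (_ : \sum_i _ = y ^+ e * \sum_i ev y (q i) * (z i / (1 + z i))); last first.
  rewrite mulr_sumr; apply: eq_bigr => j _.
  by rewrite pE rmorphM rmorphXn /= pevX -!mulrA mulrCA.
move/eqP; rewrite mulf_eq0 expf_eq0 (negPf y0) andbF /= => /eqP sum0.
have [ni Wi] := z1 i.
have vi : W i (ev y (q i) * (z i / (1 + z i))) = 0.
  by rewrite !(valM (pW i)) ?mulf_neq0 ?invr_eq0 // (valV (pW i)) Wi vu subrr addr0.
have nz : ev y (q i) * (z i / (1 + z i)) != 0 by rewrite !mulf_neq0 ?invr_eq0.
case/eqP: nz; apply: (val_sum0 (pW i) _ sum0) => j ji; rewrite vi.
have [nj _] := z1 j; have ij : i != j by rewrite eq_sym.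
rewrite add0r -[1]add0r; apply: (vgeM (pW i)).
  by apply/(vge_0E (pW i))/ev_ge0 => //; exact: ltW.
right; rewrite (valM (pW i)) ?invr_eq0 // (valV (pW i)) (z2 j) // subr0.
by have [_ /(_ i ij)] := hz j; lia.
Qed.

End Approximation.

(** * Quotients by a principal submodule *)

Section Quotients.
Variables (K : finFieldType) (E : fieldType) (c : {rmorphism K -> E}).
Variables (y : E) (M : set E).
Hypotheses (y0 : y != 0) (M0 : M 0).
Hypothesis (MD : forall m m', M m -> M m' -> M (m + m')).
Hypothesis (MZ : forall a m, M m -> M (c a * m)).
Hypothesis (My : forall m, M m -> M (y * m)).

Definition indep_mod N (r : 'I_N -> E) : Prop :=
  (forall i, M (r i)) /\ forall a : 'I_N -> K,
    (exists2 m, M m & \sum_i c (a i) * r i = y * m) -> forall i, a i = 0.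

Lemma submod_sum (I : Type) (r : seq I) (P : pred I) (f : I -> E) :
  (forall i, P i -> M (f i)) -> M (\sum_(i <- r | P i) f i).
Proof. by move=> h; apply: big_ind. Qed.

Lemma submod_ev p m : M m -> M (pev c y p * m).
Proof.
move=> Mm; rewrite (pevE _ _ (leqnn _)) mulr_suml; apply: submod_sum => i _.
rewrite -mulrA; apply: MZ; elim: (nat_of_ord i) => [|k IH]; first by rewrite mul1r.
by rewrite exprS -mulrA; apply: My.
Qed.

(** Reducing a polynomial relation modulo y, after removing common factors y
    from its coefficients, gives a nontrivial relation modulo y M. *)
Lemma indep_mod_free N (r : 'I_N -> E) : indep_mod r -> ~ poly_dependent c y r.
Proof.
move=> [Mr ind] [p [pn0 sum0]].
have [e [q [pE /(_ pn0) [i0 /eqP[]]]]] := poly_family_split p.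
have {}sum0 : \sum_i pev c y (q i) * r i = 0.
  apply: (mulfI (expf_neq0 e y0)); rewrite mulr0 -[RHS]sum0 mulr_sumr.
  by apply: eq_bigr => j _; rewrite pE rmorphM rmorphXn /= pevX -mulrA mulrCA.
apply: (ind (fun i => (q i)`_0)); exists (- \sum_i pev c y (drop_poly 1 (q i)) * r i).
  rewrite -sumrN; apply: submod_sum => i _.
  by rewrite -mulNr -rmorphN; apply: submod_ev.
apply/eqP; rewrite mulrN -addr_eq0 mulr_sumr -big_split /=; apply/eqP; rewrite -[RHS]sum0.
apply: eq_bigr => i _; rewrite mulrA -mulrDl; congr (_ * _).
by rewrite [in RHS]pev_split [y * _]mulrC.
Qed.

(** A longest independent family spans: an element outside its span modulo y M
    could be added to it. *)
Lemma spanning_mod n :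
  (forall N (r : 'I_N -> E), indep_mod r -> (N <= n)%N) ->
  exists k (r : 'I_k -> E), [/\ (k <= n)%N, indep_mod r &
    forall m, M m -> exists (a : 'I_k -> K) m', M m' /\
      m = \sum_i c (a i) * r i + y * m'].
Proof.
move=> bnd; pose P N := `[< exists r : 'I_N -> E, indep_mod r >].
have P0 : exists N, P N.
  by exists 0%N; apply/asboolP; exists (fun=> 0); split=> [[]|a _ []].
have Pn N : P N -> (N <= n)%N by move=> /asboolP[r /bnd].
case: (ex_maxnP P0 Pn) => k /asboolP[r indr] kmax.
exists k, r; split=> //; first exact: bnd indr.
move=> m Mm; apply: contrapT => nspan; have [Mr ind] := indr.
suff /kmax : P k.+1 by rewrite ltnn.
apply/asboolP; exists (fun i => oapp r m (unlift ord0 i)); split=> [i|a].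
  by case: unliftP => [j|] _ /=.
move=> [m1 Mm1]; rewrite big_ord_recl unlift_none /=.
under eq_bigr do rewrite liftK /=.
move=> sumE; have a0 : a ord0 = 0.
  apply/eqP/negPn/negP => a0; apply: nspan.
  exists (fun i => - (a (lift ord0 i) / a ord0)), (c (a ord0)^-1 * m1).
  split; first exact: MZ.
  have ca0 : c (a ord0) != 0 by rewrite fmorph_eq0.
  apply: (mulfI ca0); rewrite mulrDr mulr_sumr mulrCA [c _ * (c _ * _)]mulrA -rmorphM.
  rewrite mulfV // rmorph1 mul1r -sumE [RHS]addrCA -big_split /= big1 ?addr0 // => i _.
  by rewrite rmorphN mulNr mulrN mulrA -rmorphM mulrCA mulfV // mulr1 addNr.
move: sumE; rewrite a0 rmorph0 mul0r add0r => sumE.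
have {}ind := ind (fun i => a (lift ord0 i)) (ex_intro2 _ _ _ Mm1 sumE).
by move=> i; case: (unliftP ord0 i) => [j|] ->.
Qed.

End Quotients.

(** * Regular functions *)

Lemma card_fibers (U V : finType) (phi : U -> V) (A B : {set U}) :
  (forall u0, u0 \in A -> exists2 h : U -> U, injective h &
     forall u, u \in A -> phi u = phi u0 -> h u \in B) ->
  (#|A| <= #|V| * #|B|)%N.
Proof.
move=> hAB; rewrite -sum1_card (partition_big phi xpredT) //=.
rewrite -sum_nat_const; apply: leq_sum => b _; rewrite sum1dep_card.
have [|] := boolP [exists u, (u \in A) && (phi u == b)]; last first.
  rewrite negb_exists => /forallP none; rewrite eq_card0 // => u.
  by rewrite !inE; apply: negbTE.
move=> /existsP[u0 /andP[u0A /eqP u0b]]; have [h injh hB] := hAB u0 u0A.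
set D := [set u in A | _].
rewrite -(card_imset D injh); apply/subset_leq_card/fintype.subsetP => w.
by move=> /imsetP[u]; rewrite inE => /andP[uA /eqP ub] ->; rewrite hB // ub.
Qed.

Section RegularRing.
Variables (K : finFieldType) (F : fieldType) (c : {rmorphism K -> F}).

Local Notation ev := (pev c).

Hypothesis bdep : bounded_dependent c.
Variables (oo : F -> int) (voo : valuation oo).
Hypothesis constants : forall x, algebraicOver c x -> exists a, x = c a.

Definition regular : set F :=
  [set a | forall w, valuation w -> w <> oo -> 0 <= w a].

Lemma regular_const a : regular (c a).
Proof. by move=> w pw _; rewrite (val_const c pw). Qed.

Lemma regular0 : regular 0.
Proof. by move=> w pw _; rewrite (val0 pw). Qed.

Lemma regular1 : regular 1.
Proof. by move=> w pw _; rewrite (val1 pw). Qed.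

Lemma regularD a b : regular a -> regular b -> regular (a + b).
Proof. by move=> ha hb w pw woo; apply: (val_ge0D pw); [exact: ha|exact: hb]. Qed.

Lemma regularM a b : regular a -> regular b -> regular (a * b).
Proof. by move=> ha hb w pw woo; apply: (val_ge0M pw); [exact: ha|exact: hb]. Qed.

Lemma regularN a : regular a -> regular (- a).
Proof. by move=> ha w pw woo; rewrite (valN pw) ha. Qed.

Lemma regularX a n : regular a -> regular (a ^+ n).
Proof.
move=> ha; elim: n => [|n IH]; first by rewrite expr0; exact: regular1.
by rewrite exprS; exact: regularM.
Qed.

Lemma regular_ev a p : regular a -> regular (ev a p).
Proof. by move=> ha w pw woo; apply: (ev_ge0 c pw); exact: ha. Qed.

Lemma not_transcendental x : ~ transcendental c x -> exists a, x = c a.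
Proof.
move=> nt; apply: constants; apply: contrapT => nalg; apply: nt => p p0.
by apply/negP => /eqP px; apply: nalg; exists p => //; apply/rootP.
Qed.

Lemma bounded_family y : exists n, forall N (f : 'I_N -> F),
  (n < N)%N -> poly_dependent c y f.
Proof.
have [n hn] := bdep y; exists n => N f lt.
have [|p [p0 /(_ ord0) sum0]] := hn 1 N (fun i _ => f i); first by rewrite muln1.
by exists p.
Qed.

(** Clearing poles: a nonzero polynomial in x is a denominator of u wherever
    x is regular. *)
Lemma integral_multiple x u : transcendental c x -> exists2 p, p != 0 &
  forall w, valuation w -> 0 <= w x -> 0 <= w (ev x p * u).
Proof.
move=> tx; have [n hn] := bounded_family x.
have [p [[i0 pi0] sum0]] := hn n.+1 (fun i => u ^+ i) (ltnSn n).
pose P i := (i <= n)%N && (p (inord i) != 0).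
have Pn i : P i -> (i <= n)%N by case/andP.
have P0 : exists i, P i.
  by exists i0; rewrite /P inord_val pi0 -ltnS ltn_ord.
case: (ex_maxnP P0 Pn) => k /andP[kn pk0] kmax.
exists (p (inord k)) => // w pw wx.
pose a (i : nat) := ev x (p (inord i)).
rewrite -[ev _ _]/(a (@ord_max k)); apply: (val_integral pw (a := a \o @nat_of_ord _)).
  by move=> i; exact: (ev_ge0 c pw).
rewrite -[RHS]sum0 (big_ord_widen n.+1 (fun i => a i * u ^+ i)) //.
rewrite big_mkcond; apply: eq_bigr => i _.
rewrite /a inord_val; case: ifPn => // ki.
suff -> : p i = 0 by rewrite rmorph0 mul0r.
apply/eqP/negPn/negP => pi; move: ki; rewrite ltnS kmax // /P inord_val pi.
by rewrite -ltnS ltn_ord.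
Qed.

(** Where y vanishes, a polynomial in y is a power of y up to a unit; so the
    previous lemma bounds the poles of u there by a power of y. *)
Lemma pole_bound y u : transcendental c y ->
  exists e, forall w, valuation w -> 0 < w y -> 0 <= w (y ^+ e * u).
Proof.
move=> ty; have [p p0 hp] := integral_multiple u ty.
have [e [q [pE q0]]] := poly_family_split (fun _ : 'I_1 => p).
have [|i qi] := q0; first by exists ord0.
exists e => w pw wy; have := hp w pw (ltW wy).
have [nz vq] := ev_unit c pw wy qi.
rewrite (pE i) rmorphM rmorphXn /= pevX -mulrA.
have [->|yu] := eqVneq (y ^+ e * u) 0; first by rewrite (val0 pw).
by rewrite (valM pw) // vq add0r.
Qed.

(** Reverse the coefficients and multiply by a power of y. *)
Lemma poly_dependent_inv y N (f : 'I_N -> F) : y != 0 ->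
  poly_dependent c y^-1 f -> poly_dependent c y f.
Proof.
move=> y0 [p [[i0 pi0] sum0]]; pose m := \max_i size (p i).
have sm i : (size (p i) <= m)%N by exact: leq_bigmax.
exists (fun i => \poly_(j < m) (p i)`_(m.-1 - j)); split.
  exists i0; apply: contra pi0 => /eqP h; apply/eqP/polyP => j; rewrite coef0.
  have [jm|jm] := ltnP j m; last by apply: nth_default; exact: leq_trans (sm i0) jm.
  have := congr1 (fun q : {poly K} => q`_(m.-1 - j)) h.
  rewrite coef_poly coef0 ifT; last by lia.
  by rewrite subKn //; lia.
transitivity (y ^+ m.-1 * \sum_i ev y^-1 (p i) * f i); last by rewrite sum0 mulr0.
rewrite mulr_sumr; apply: eq_bigr => i _.
rewrite (pevE _ _ (size_poly _ _)) (pevE _ _ (sm i)) mulrA; congr (_ * _).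
rewrite mulr_sumr (reindex_inj rev_ord_inj); apply: eq_bigr => j _ /=.
have jm := ltn_ord j.
rewrite coef_poly ifT; last by lia.
have -> : (m.-1 - (m - j.+1) = j)%N by lia.
rewrite mulrCA; congr (_ * _); rewrite exprVn -expfB_cond; last by rewrite (negPf y0); lia.
by congr (_ ^+ _); lia.
Qed.

(** The zeros of y other than oo being finite in number, a function exists with
    a pole at oo and none at these. *)
Lemma pole_only_at_oo y : 0 < oo y -> exists z, oo z < 0 /\
  forall w, valuation w -> w <> oo -> 0 < w y -> 0 <= w z.
Proof.
move=> ooy; have [n hn] := bounded_family y.
pose P N := `[< exists W : 'I_N -> F -> int, injective W /\
  forall i, [/\ valuation (W i), W i <> oo & 0 < W i y] >].
have P0 : exists N, P N by exists 0%N; apply/asboolP; exists (fun=> oo); split=> -[].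
have Pn N : P N -> (N <= n)%N.
  by move=> /asboolP[W [iW hW]]; apply: (few_zeros hn iW) => i; have [] := hW i.
case: (ex_maxnP P0 Pn) => k /asboolP[W [iW hW]] kmax.
have [|z [ooz Wz]] := weak_approximation (W := W) (s := enum 'I_k) voo.
  by move=> i _; have [] := hW i.
exists z; split=> // w pw woo wy.
have [[i ->]|nW] := pselect (exists i, w = W i).
  by apply/ltW/Wz; rewrite mem_enum.
suff /kmax : P k.+1 by rewrite ltnn.
apply/asboolP; exists (fun i => oapp W w (unlift ord0 i)); split=> [i j|i].
  case: (unliftP ord0 i) => [i'|] ->; case: (unliftP ord0 j) => [j'|] -> //=.
  - by move=> /iW ->.
  - by move=> wE; case: nW; exists i'.
  - by move=> wE; case: nW; exists j'.
by case: unliftP => [j|] _ /=.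
Qed.

Section Riemann.
Variables (y : F) (ooy : 0 < oo y).

Let ty : transcendental c y := val_transcendental c voo ooy.

Let y0 : y != 0.
Proof. by apply: contraTneq ooy => ->; rewrite (val0 voo). Qed.

Let x := y^-1.

Let x0 : x != 0. Proof. by rewrite invr_eq0. Qed.

Let tx : transcendental c x.
Proof.
move=> p p0; apply/negP => /eqP px.
have [|q [[i q0]]] := @poly_dependent_inv y 1 (fun=> 1) y0.
  by exists (fun=> p); split; [exists ord0|rewrite big_ord1 px mul0r].
by rewrite big_ord1 mulr1; move/eqP; apply/negP; rewrite (ord1 i) in q0; exact: ty.
Qed.

Let R : set F := [set z | forall w, valuation w -> w <> oo -> 0 < w y -> 0 <= w z].

Let R0 : R 0. Proof. by move=> w pw _ _; rewrite (val0 pw). Qed.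

Let RM a b : R a -> R b -> R (a * b).
Proof. by move=> ha hb w pw h h'; apply: (val_ge0M pw); [exact: ha|exact: hb]. Qed.

Let RD a b : R a -> R b -> R (a + b).
Proof. by move=> ha hb w pw h h'; apply: (val_ge0D pw); [exact: ha|exact: hb]. Qed.

Let Rc a : R (c a). Proof. by move=> w pw _ _; rewrite (val_const c pw). Qed.

Let Ry : R y. Proof. by move=> w pw _ /ltW. Qed.

Let RX a n : R a -> R (a ^+ n).
Proof.
by move=> Ra; elim: n => [|n IH]; rewrite ?expr0 ?exprS; [rewrite -(rmorph1 c)|exact: RM].
Qed.

Let Ra_sum (I : Type) (r : seq I) (P : pred I) (f : I -> F) :
  (forall i, P i -> R (f i)) -> R (\sum_(i <- r | P i) f i).
Proof. by move=> h; apply: big_ind. Qed.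

(** Functions regular at the zeros of y other than oo, taken modulo y, are
    fewer than the degree of F over K(y): a function with a high pole at oo is
    independent from any of them. *)
Lemma indep_mod_extend N (r : 'I_N -> F) : indep_mod c y R r ->
  exists f : 'I_N.+1 -> F, ~ poly_dependent c y f.
Proof.
move=> indr; have [Rr ind] := indr.
have [z0 [ooz0 Rz0]] := pole_only_at_oo ooy.
(* A power of z0 whose pole at oo exceeds those of all the r i. *)
pose k := (\sum_i `|oo (r i)|).+1.
pose z := z0 ^+ k.
have ooz i : oo z < oo (r i).
  have : (`|oo (r i)| <= \sum_i `|oo (r i)|)%N by rewrite (bigD1 i) //= leq_addr.
  rewrite /z (valX voo) /k; move: (\sum_i _)%N ooz0 => S; rewrite -mulr_natr natz.
  by move: (oo (r i)) (oo z0) => a b; nia.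
have ooz1 : oo z < 0 by rewrite (valX voo) pmulrn_llt0.
have Rz : R z by apply: RX => w pw h h'; exact: Rz0.
exists (fun i => oapp r z (unlift ord0 i)) => -[p [pn0 sum0]].
have [e [q [pE /(_ pn0) qn0]]] := poly_family_split p.
have {}sum0 : \sum_i ev y (q i) * oapp r z (unlift ord0 i) = 0.
  apply: (mulfI (expf_neq0 e y0)); rewrite mulr0 -[RHS]sum0 mulr_sumr.
  by apply: eq_bigr => j _; rewrite pE rmorphM rmorphXn /= pevX -mulrA mulrCA.
have q00 : (q ord0)`_0 = 0.
  apply/eqP/negPn/negP => q0; have [nz vq] := ev_unit c voo ooy q0.
  have z0' : z != 0 by apply: contraTneq ooz1 => ->; rewrite (val0 voo).
  have nz' : ev y (q ord0) * z != 0 by rewrite mulf_neq0.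
  case/eqP: (nz'); rewrite -[z]/(oapp r z None) -(unlift_none ord0).
  apply: (val_sum0 voo (f := fun i => ev y (q i) * oapp r z (unlift ord0 i)) _ sum0).
  move=> i; case: (unliftP ord0 i) => [j|] -> //= _.
  rewrite unlift_none /= (valM voo) // vq add0r -[_ + 1]add0r.
  apply: (vgeM voo); first by apply/(vge_0E voo)/ev_ge0 => //; exact: ltW.
  by right; have := ooz j; lia.
move: qn0 => [i]; case: (unliftP ord0 i) => [j|] ->; last by rewrite q00 eqxx.
case/eqP; move: j; apply: (ind (fun i => (q (lift ord0 i))`_0)).
exists (- (ev y (drop_poly 1 (q ord0)) * z +
          \sum_j ev y (drop_poly 1 (q (lift ord0 j))) * r j)).
  rewrite -mulN1r; apply: RM; first by rewrite -(rmorph1 c) -rmorphN.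
  have Rev p' : R (ev y p') by move=> w pw _ /ltW; exact: (ev_ge0 c pw).
  by apply: RD; [exact: RM|apply: Ra_sum => j _; exact: RM].
apply/eqP; rewrite mulrN -addr_eq0; apply/eqP; rewrite -[RHS]sum0 big_ord_recl.
rewrite unlift_none /= [in RHS]pev_split q00 rmorph0 add0r mulrDr addrCA.
congr (_ + _); first by rewrite mulrA [y * _]mulrC.
rewrite mulr_sumr -big_split; apply: eq_bigr => j _ /=.
by rewrite liftK /= [in RHS]pev_split mulrDl mulrA [y * _]mulrC.
Qed.

(** An instance of Riemann's inequality: the combinations of an
    integral basis over K[x] with coefficients of degree < m form a space of
    dimension n m, on which regularity away from oo amounts to (n - 1) m + O(1)
    linear conditions. *)
Lemma regular_transcendental_of_zero : exists a, regular a /\ transcendental c a.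
Proof.
have [b hb] := bounded_family x.
pose P N := `[< exists f : 'I_N -> F, ~ poly_dependent c x f >].
have P0 : exists N, P N.
  by exists 0%N; apply/asboolP; exists (fun=> 0) => -[p [[[]]]].
have Pb N : P N -> (N <= b)%N.
  by move=> /asboolP[f ndf]; rewrite leqNgt; apply/negP => /(hb _ f).
case: (ex_maxnP P0 Pb) => n /asboolP[u ndu] nmax.
have /choice[d hd] j : exists p, p != 0 /\
    forall w, valuation w -> 0 <= w x -> 0 <= w (ev x p * u j).
  by have [p p0 hp] := integral_multiple (u j) tx; exists p.
have dn0 j : d j != 0 by have [] := hd j.
pose v j := ev x (d j) * u j.
have v_int j w : valuation w -> 0 <= w x -> 0 <= w (v j).
  by have [_] := hd j; apply.
have ndv : ~ poly_dependent c x v.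
  move=> [p [[i pi] sum0]]; apply: ndu; exists (fun i => p i * d i); split.
    by exists i; rewrite mulf_neq0.
  by rewrite -[RHS]sum0; apply: eq_bigr => j _; rewrite rmorphM /= mulrA.
have /choice[e he] j := pole_bound (v j) ty.
pose c0 := (\sum_j e j)%N.
have Re j : R (y ^+ c0 * v j).
  have le : (e j <= c0)%N by rewrite /c0 (bigD1 j) //= leq_addr.
  rewrite -(subnK le) exprD -mulrA; apply: RM; first exact: RX.
  by move=> w pw _; exact: he.
have [k [r [_ indr span]]] : exists k (r : 'I_k -> F), [/\ (k <= n.-1)%N,
    indep_mod c y R r & forall m, R m -> exists (a : 'I_k -> K) m', R m' /\
      m = \sum_i c (a i) * r i + y * m'].
  apply: spanning_mod => [||N r indr]; [exact: R0|by move=> a m; apply: RM|].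
  have [f ndf] := indep_mod_extend indr.
  suff : (N < n)%N by lia.
  apply: nmax; apply/asboolP; exists f => dep; apply: ndf.
  by apply: poly_dependent_inv => //; rewrite -/x.
have kn : (k < n)%N.
  have [f ndf] := indep_mod_extend indr; apply: nmax; apply/asboolP; exists f => dep.
  by apply: ndf; apply: poly_dependent_inv => //; rewrite -/x.
(* As k < n, this makes n m - k (m + c0) at least 2. *)
pose m := (k * c0).+2.
pose psi (M : 'M[K]_(n, m)) := \sum_j ev x (rVpoly (row j M)) * v j.
have psiB M M' : psi (M - M') = psi M - psi M'.
  rewrite /psi -sumrB; apply: eq_bigr => j _.
  by rewrite !linearB rmorphB mulrBl.
have psi_inj : injective psi.
  move=> M M' /eqP; rewrite -subr_eq0 -psiB => /eqP psi0.
  apply/eqP; rewrite -subr_eq0; apply/eqP/row_matrixP => j; apply/eqP.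
  rewrite row0 -[row _ _]rVpolyK; apply/negPn/negP => nz; apply: ndv.
  exists (fun j => rVpoly (row j (M - M'))); split=> //; exists j.
  by apply: contraNneq nz => ->; rewrite linear0.
(* S 0 parametrises regular functions, and S (m + c0) contains everything. *)
pose S i : {set 'M[K]_(n, m)} := finset (fun M => `[< R (y ^+ i * psi M) >]).
have SP i M : reflect (R (y ^+ i * psi M)) (M \in S i).
  by rewrite inE; exact: asboolP.
have S_full : #|S (m + c0)%N| = (#|K| ^ (n * m))%N.
  rewrite -card_mx; apply: eq_card => M; rewrite [RHS]inE; apply/SP.
  rewrite mulr_sumr; apply: Ra_sum => j _.
  rewrite (pevE _ _ (size_poly _ _)) mulr_suml mulr_sumr; apply: Ra_sum => i _.
  have im := ltn_ord i; have le := ltnW im.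
  have -> : y ^+ (m + c0) * (c (rVpoly (row j M))`_i * x ^+ i * v j) =
     c (rVpoly (row j M))`_i * (y ^+ (m - i) * (y ^+ c0 * v j)).
    have yx : y ^+ i * x ^+ i = 1 by rewrite /x exprVn mulfV // expf_neq0.
    rewrite -{1}(subnK le) !exprD -[RHS]mulr1 -yx.
    by move: (y ^+ _) (y ^+ i) (y ^+ c0) (c _) (x ^+ i) (v j) => *; ring.
  by apply: RM => //; apply: RM => //; exact: RX.
have S_step i : (#|S i.+1| <= #|K| ^ k * #|S i|)%N.
  have /choice[phi hphi] M : exists a : {ffun 'I_k -> K}, R (y ^+ i.+1 * psi M) ->
      exists2 m', R m' & y ^+ i.+1 * psi M = \sum_i c (a i) * r i + y * m'.
    have [RM'|nR] := pselect (R (y ^+ i.+1 * psi M)); last by exists [ffun=> 0].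
    have [a [m' [Rm' E]]] := span _ RM'; exists (finfun a) => _; exists m' => //.
    by rewrite E; congr (_ + _); apply: eq_bigr => l _; rewrite ffunE.
  have := @card_fibers _ _ phi (S i.+1) (S i) _; rewrite card_ffun card_ord; apply.
  move=> M0 /SP RM0; exists (fun M => M - M0); first exact: addIr.
  move=> M /SP RM1 phiE; apply/SP.
  have [m0 Rm0 E0] := hphi _ RM0; have [m1 Rm1 E1] := hphi _ RM1.
  have : y ^+ i.+1 * psi (M - M0) = y * (m1 - m0).
    by rewrite psiB mulrBr E0 E1 phiE opprD addrACA subrr add0r mulrBr.
  rewrite exprS -mulrA => /(mulfI y0) ->; apply: RD => //.
  by rewrite -mulN1r -(rmorph1 c) -rmorphN; exact: RM.
have S_le i : (#|S i| <= #|K| ^ (k * i) * #|S 0%N|)%N.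
  elim: i => [|i IH]; first by rewrite muln0 expn0 mul1n.
  by rewrite mulnS expnD -mulnA; apply: leq_trans (S_step i) _; rewrite leq_mul2l IH orbT.
have S0_big : (#|K| < #|S 0%N|)%N.
  have q1 := finRing_gt1 K; rewrite ltnNge; apply/negP => le.
  have := S_le (m + c0)%N; rewrite S_full leqNgt => /negP; apply.
  apply: (@leq_ltn_trans (#|K| ^ (k * (m + c0) + 1))).
    by rewrite expnD expn1 leq_mul2l le orbT.
  rewrite ltn_exp2l //; have : (k.+1 * m <= n * m)%N by rewrite leq_mul2r kn orbT.
  by apply: leq_trans; rewrite mulSn mulnDr [X in (X.+1 <= _)%N]addnAC /m; lia.
have regS M : M \in S 0%N -> regular (psi M).
  move=> /SP; rewrite expr0 mul1r => RM1 w pw woo.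
  have [wx|wx] := leP 0 (w x).
    apply/(vge_0E pw)/(vge_sum pw) => j _; apply/(vge_0E pw)/(val_ge0M pw).
      exact: (ev_ge0 c pw).
    exact: v_int.
  by apply: RM1 => //; move: wx; rewrite /x (valV pw) oppr_lt0.
(* The constants are only |K| regular functions. *)
apply: contrapT => none.
have /choice[a ha] M : exists a : K, M \in S 0%N -> psi M = c a.
  have [MS|] := boolP (M \in S 0%N); last by exists 0.
  have [|a ->] := @not_transcendental (psi M); last by exists a.
  by move=> t; apply: none; exists (psi M); split=> //; exact: regS.
have : (#|S 0%N| <= #|K|)%N.
  rewrite -(@card_in_imset _ _ a) ?max_card // => M M' MS M'S aE.
  by apply: psi_inj; rewrite !ha // aE.
by rewrite leqNgt S0_big.
Qed.

End Riemann.

End RegularRing.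

(** * Modules over a subring of a field *)

Section Modules.
Variables (F : fieldType) (A : set F).

Record subring : Prop := Subring {
  subring0 : A 0;
  subring1 : A 1;
  subringD : forall a b, A a -> A b -> A (a + b);
  subringM : forall a b, A a -> A b -> A (a * b) }.

Hypothesis sA : subring.

Let A0 := subring0 sA.
Let A1 := subring1 sA.
Let AD := subringD sA.
Let AM := subringM sA.

Lemma subring_sum (I : Type) (r : seq I) (P : pred I) (f : I -> F) :
  (forall i, P i -> A (f i)) -> A (\sum_(i <- r | P i) f i).
Proof. by move=> h; apply: big_ind. Qed.

Section Action.
Variables (V : zmodType) (act : F -> V -> V).

Record vector_action : Prop := VectorAction {
  vactDl : forall a b v, act (a + b) v = act a v + act b v;
  vactDr : forall a v w, act a (v + w) = act a v + act a w;
  vactM : forall a b v, act (a * b) v = act a (act b v);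
  vact1 : forall v, act 1 v = v }.

Hypothesis vact : vector_action.

Let actDl := vactDl vact.
Let actDr := vactDr vact.
Let actM := vactM vact.
Let act1 := vact1 vact.

Record submodule (M : set V) : Prop := Submodule {
  submodule0 : M 0;
  submoduleD : forall v w, M v -> M w -> M (v + w);
  submodule_act : forall a v, A a -> M v -> M (act a v) }.

Lemma act0l v : act 0 v = 0.
Proof. by apply: (addrI (act 0 v)); rewrite -actDl !addr0. Qed.

Lemma act0r a : act a 0 = 0.
Proof. by apply: (addrI (act a 0)); rewrite -actDr !addr0. Qed.

Lemma act_suml (I : Type) (r : seq I) (P : pred I) (f : I -> F) v :
  act (\sum_(i <- r | P i) f i) v = \sum_(i <- r | P i) act (f i) v.
Proof. by elim/big_rec2: _ => [|i x y _ <-]; rewrite ?act0l ?actDl. Qed.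

Lemma act_sumr (I : Type) (r : seq I) (P : pred I) a (f : I -> V) :
  act a (\sum_(i <- r | P i) f i) = \sum_(i <- r | P i) act a (f i).
Proof. by elim/big_rec2: _ => [|i x y _ <-]; rewrite ?act0r ?actDr. Qed.

Lemma fg_fin (T : finType) (g : T -> V) : fg_submodule A act
  [set m | exists a : T -> F, (forall i, A (a i)) /\ m = \sum_i act (a i) (g i)].
Proof.
exists #|T|, (fun i => g (enum_val i)); apply/seteqP; split=> m /= [a [Aa ->]].
  exists (fun i => a (enum_val i)); split=> //.
  by rewrite (reindex _ (onW_bij _ (enum_val_bij T))).
exists (fun t => a (enum_rank t)); split=> //.
rewrite (reindex _ (onW_bij _ (enum_rank_bij T))) /=.
by apply: eq_bigr => t _; rewrite enum_rankK.
Qed.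

Lemma fg_submodule_submodule M : fg_submodule A act M -> submodule M.
Proof.
move=> [n [g ->]]; split=> /= [|v w [a [Aa ->]] [b [Ab ->]]|a v Aa [b [Ab ->]]].
- by exists (fun=> 0); split=> //; rewrite big1 // => i _; rewrite act0l.
- exists (fun i => a i + b i); split=> [i|]; first exact: AD.
  by rewrite -big_split; apply: eq_bigr => i _; rewrite actDl.
exists (fun i => a * b i); split=> [i|]; first exact: AM.
by rewrite act_sumr; apply: eq_bigr => i _; rewrite actM.
Qed.

Lemma fg_generator M n (g : 'I_n -> V) i :
  M = [set m | exists a : 'I_n -> F, (forall i, A (a i)) /\ m = \sum_i act (a i) (g i)] ->
  M (g i).
Proof.
move=> -> /=; exists (fun j => if j == i then 1 else 0); split.
  by move=> j; case: ifP.
rewrite (bigD1 i) //= eqxx act1 big1 ?addr0 // => j /negPf ->.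
by rewrite act0l.
Qed.

Lemma module_prod_mem (I : set F) (M : set V) x m :
  I x -> M m -> module_prod act I M (act x m).
Proof.
move=> Ix Mm; exists 1%N, (fun=> x), (fun=> m); split=> //.
by rewrite big_ord1.
Qed.

Lemma module_prod0 I M : module_prod act I M 0.
Proof. by exists 0%N, (fun=> 0), (fun=> 0); split=> [[]|[]|] //; rewrite big_ord0. Qed.

Lemma module_prodD I M v w :
  module_prod act I M v -> module_prod act I M w -> module_prod act I M (v + w).
Proof.
move=> [n [x [y [Ix My ->]]]] [m [x' [y' [Ix' My' ->]]]].
pose glue T (f : 'I_n -> T) (f' : 'I_m -> T) i :=
  match fintype.split i with inl j => f j | inr j => f' j end.
exists (n + m)%N, (glue _ x x'), (glue _ y y'); split=> [i|i|].
- by rewrite /glue; case: fintype.split.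
- by rewrite /glue; case: fintype.split.
rewrite big_split_ord /=; congr (_ + _); apply: eq_bigr => i _; rewrite /glue.
  by case: fintype.split (unsplitK (inl i : 'I_n + 'I_m)%type) => j // [->].
by case: fintype.split (unsplitK (inr i : 'I_n + 'I_m)%type) => j // [->].
Qed.

Lemma module_prod_ind (I : set F) (M N : set V) :
  N 0 -> (forall v w, N v -> N w -> N (v + w)) ->
  (forall x m, I x -> M m -> N (act x m)) -> module_prod act I M `<=` N.
Proof.
move=> N0 ND h v [n [x [y [Ix My ->]]]]; apply: big_ind => // i _; exact: h.
Qed.

Lemma fg_module_prod I M : fg_submodule A *%R I -> fg_submodule A act M ->
  fg_submodule A act (module_prod act I M).
Proof.
move=> [n [g Ig]] [m [h Mh]].
have := fg_fin (fun ij : 'I_n * 'I_m => act (g ij.1) (h ij.2)).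
set S := [set _ | _]; suff -> : module_prod act I M = S by [].
apply/seteqP; split.
  apply: module_prod_ind => /=.
  - by exists (fun=> 0); split=> //; rewrite big1 // => i _; rewrite act0l.
  - move=> v w [a [Aa ->]] [b [Ab ->]]; exists (fun i => a i + b i).
    split=> [i|]; first exact: AD.
    by rewrite -big_split; apply: eq_bigr => i _; rewrite actDl.
  move=> x v; rewrite Ig Mh => -[a [Aa ->]] [b [Ab ->]].
  exists (fun ij => a ij.1 * b ij.2); split=> [i|]; first exact: AM.
  rewrite -(pair_bigA _ (fun i j => act (a i * b j) (act (g i) (h j)))) /= act_suml.
  apply: eq_bigr => i _; rewrite act_sumr; apply: eq_bigr => j _.
  by rewrite -!actM; congr act; rewrite -!mulrA; congr (_ * _); rewrite mulrC.
move=> v [a [Aa ->]]; apply: big_ind => [||ij _].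
- exact: module_prod0.
- exact: module_prodD.
rewrite -actM; apply: module_prod_mem; last exact: fg_generator Mh.
rewrite Ig; exists (fun i => if i == ij.1 then a ij else 0); split.
  by move=> i; case: ifP.
rewrite (bigD1 ij.1) //= eqxx big1 ?addr0 // => j /negPf ->.
by rewrite mul0r.
Qed.

(** Invertibility of J describes division by J through J itself, without
    reference to generators of the inverse. *)
Lemma ideal_inv_prodP J M v : ideal_mul (ideal_inv A J) J 1 -> submodule M ->
  module_prod act (ideal_inv A J) M v <-> forall y, J y -> M (act y v).
Proof.
move=> inv1 sM; split=> [pv y Jy|h].
  move: pv; move: v; apply: module_prod_ind => [|v w|x m ix Mm].
  - by rewrite act0r; exact: submodule0.
  - by rewrite actDr; exact: submoduleD.
  by rewrite -actM mulrC; apply: submodule_act => //; exact: ix.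
have [n [x [y [ix Jy E]]]] := inv1; rewrite -(act1 v) E act_suml.
exists n, x, (fun i => act (y i) v); split=> // [i|]; first exact: h.
by apply: eq_bigr => i _; rewrite actM.
Qed.

Lemma has_rank_module_prod I M n : (exists2 x, I x & x != 0) ->
  has_rank act M n -> has_rank act (module_prod act I M) n.
Proof.
move=> [x0 Ix0 x0n] [b [Mb indb spanb]]; exists (fun i => act x0 (b i)); split.
- by move=> i; exact: module_prod_mem.
- move=> c; under eq_bigr do rewrite -actM.
  by move=> /indb h i; apply: (mulIf x0n); rewrite mul0r h.
move=> m; apply: (module_prod_ind
    (N := [set m | exists c : 'I_n -> F, m = \sum_i act (c i) (act x0 (b i))])) => /=.
- by exists (fun=> 0); rewrite big1 // => i _; rewrite act0l.
- move=> v w [c ->] [d ->]; exists (fun i => c i + d i).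
  by rewrite -big_split; apply: eq_bigr => i _; rewrite actDl.
move=> x v Ix /spanb[c ->]; exists (fun i => x * c i / x0).
by rewrite act_sumr; apply: eq_bigr => i _; rewrite -!actM mulfVK.
Qed.

End Action.
End Modules.

(** * Fractional ideals are invertible *)

Section Dedekind.
Variables (K : finFieldType) (F : fieldType) (c : {rmorphism K -> F}).
Hypothesis bdep : bounded_dependent c.
Variables (oo : F -> int) (voo : valuation oo).
Hypothesis constants : forall x, algebraicOver c x -> exists a, x = c a.

Local Notation A := (regular oo).
Local Notation ev := (pev c).

Lemma regular_subring : subring A.
Proof.
by split; [exact: (@regular0 F oo)|exact: (@regular1 F oo)|exact: regularD|exact: regularM].
Qed.

Lemma mul_action : vector_action ( *%R : F -> F -> F).
Proof. by split=> *; rewrite ?mulrDl ?mulrDr ?mulrA ?mul1r. Qed.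

Lemma regular_transcendental : exists a, A a /\ transcendental c a.
Proof.
have [y _ ooy] := val_normalised voo.
by apply: (regular_transcendental_of_zero bdep voo constants (y := y)); rewrite ooy.
Qed.

(** F is algebraic over K(a) for any transcendental a in A, and a polynomial in a
    clearing the poles of x at all places but oo lies in A. *)
Lemma regular_denominator x : exists2 d, A d /\ d != 0 & A (d * x).
Proof.
have [a [Aa ta]] := regular_transcendental.
have [p p0 hp] := integral_multiple bdep x ta.
exists (ev a p); first by split; [exact: (regular_ev c)|exact: ta].
by move=> w pw woo; apply: hp => //; exact: Aa.
Qed.

(** Elements of A independent over the constants modulo d are independent over
    K[d], so that A/dA is finite. *)
Lemma regular_quotient d : A d -> d != 0 -> exists k (r : 'I_k -> F),
  (forall i, A (r i)) /\ forall a, A a -> exists (b : 'I_k -> K) a', A a' /\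
     a = \sum_i c (b i) * r i + d * a'.
Proof.
move=> Ad d0; have [td|/(not_transcendental constants)[b dE]] := pselect (transcendental c d).
  have [n hn] := bounded_family bdep d.
  have AZ a m : A m -> A (c a * m) by apply: regularM; exact: regular_const.
  have bnd N (r : 'I_N -> F) : indep_mod c d A r -> (N <= n)%N.
    move=> indr; rewrite leqNgt; apply/negP => /(hn _ r); apply: indep_mod_free indr => //.
    - exact: (@regular0 F oo).
    - exact: regularD.
    by move=> m Am; exact: regularM.
  have [k [r [_ [Ar _] span]]] := spanning_mod (@regular0 F oo) AZ bnd.
  by exists k, r.
exists 0%N, (fun=> 0); split=> [[]//|a Aa]; exists (fun=> 0), (c b^-1 * a); split.
  by apply: regularM => //; exact: regular_const.
by rewrite big_ord0 add0r mulrA fmorphV -dE mulfV // mul1r.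
Qed.

(** A is completely integrally closed, being an intersection of discrete
    valuation rings. *)
Lemma regular_closed (M : set F) e m0 x : e != 0 -> m0 != 0 -> M m0 ->
  (forall m, M m -> A (e * m)) -> (forall m, M m -> M (x * m)) -> A x.
Proof.
move=> e0 m00 Mm0 bnd stab w pw woo.
have Mx n : M (x ^+ n * m0).
  by elim: n => [|n IH]; rewrite ?expr0 ?mul1r // exprS -mulrA; exact: stab.
have [->|x0] := eqVneq x 0; first by rewrite (val0 pw).
rewrite leNgt; apply/negP => wx.
have := bnd _ (Mx (`|w (e * m0)|).+1) w pw woo.
move E : (w (e * m0)) => a; rewrite mulrCA (valM pw) ?expf_neq0 ?mulf_neq0 //.
by rewrite (valX pw) E; move: wx; rewrite -mulr_natr natz; move: (w x) => b; nia.
Qed.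

(** In the finite ring A/dA a proper ideal has a nonzero annihilator b: among
    the b outside b I + dA, which exist since 1 is one of them, take one with
    bA + dA minimal. *)
Lemma proper_ideal_colon (I : set F) d : d != 0 -> I d -> I `<=` A -> ~ I 1 ->
  (forall s t, I s -> I t -> I (s + t)) -> (forall a s, A a -> I s -> I (a * s)) ->
  exists2 x, ~ A x & forall t, I t -> A (x * t).
Proof.
move=> d0 Id IA nI1 ID IM; have Ad := IA _ Id.
have AM := @regularM F oo; have AD := @regularD F oo; have AN := @regularN F oo.
have A1 : A 1 := @regular1 F oo; have A0 : A 0 := @regular0 F oo.
have I0 : I 0 by rewrite -(mul0r d); exact: IM.
have IN s : I s -> I (- s) by rewrite -mulN1r; apply: IM; exact: AN.
have [k [r [Ar span]]] := regular_quotient Ad d0.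
pose princ b x := exists u t, [/\ A u, A t & x = b * u + d * t].
pose G b := A b /\ ~ exists s t, [/\ I s, A t & b = b * s + d * t].
pose S b := [pred a : {ffun 'I_k -> K} | `[< princ b (\sum_i c (a i) * r i) >]].
(* Counting representatives measures the ideal b A + d A. *)
pose mu b := #|S b|.
have SP b (a : {ffun 'I_k -> K}) :
    reflect (princ b (\sum_i c (a i) * r i)) (a \in S b) by exact: asboolP.
have princ_trans b b' x : princ b b' -> princ b' x -> princ b x.
  move=> [u [t [Au At ->]]] [u' [t' [Au' At' ->]]].
  by exists (u * u'), (t * u' + t'); split; [exact: AM|by apply: AD => //; exact: AM|ring].
have princE b x : A x -> princ b x <-> exists2 a : {ffun 'I_k -> K},
    princ b (\sum_i c (a i) * r i) & exists2 t, A t & x = \sum_i c (a i) * r i + d * t.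
  move=> Ax; split=> [[u [t [Au At E]]]|[a [u [t [Au At ->]]] [t' At' ->]]]; last first.
    by exists u, (t + t'); split; [| exact: AD|ring].
  have [a [t' [At' E']]] := span x Ax; exists (finfun a).
    exists u, (t - t'); split=> //; first by apply: AD => //; exact: AN.
    under eq_bigr do rewrite ffunE.
    by apply: (addIr (d * t')); rewrite -E' E; ring.
  by exists t' => //; under eq_bigr do rewrite ffunE.
have mu_min b b' : A b -> A b' -> princ b b' -> (mu b <= mu b')%N -> princ b' b.
  move=> Ab Ab' bb' le.
  have sub : {subset S b' <= S b}.
    by move=> a /SP h; apply/SP; exact: (princ_trans _ _ _ bb' h).
  have := subset_leqif_card (introT fintype.subsetP sub).
  move=> [_ eqc]; move: (eqc); rewrite eqn_leq le andbT.
  have -> : (mu b' <= mu b)%N by apply: subset_leq_card; apply/fintype.subsetP.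
  move=> /esym/fintype.subsetP sup.
  have [|a ha [t At E]] := (princE b b Ab).1 _.
    by exists 1, 0; split=> //; rewrite mulr1 mulr0 addr0.
  apply/(princE b' b Ab); exists a; last by exists t.
  by apply/SP; apply: (sup a); apply/SP.
have [b [Gb bmin]] : exists b, G b /\ forall b', G b' -> (mu b <= mu b')%N.
  have ex : exists n, `[< exists2 b, G b & mu b = n >].
    exists (mu 1); apply/asboolP; exists 1 => //; split=> // -[s [t [Is At E]]].
    by apply: nI1; rewrite E mul1r; apply: ID => //; rewrite mulrC; exact: IM.
  case: (ex_minnP ex) => n /asboolP[b Gb <-] nmin; exists b; split=> // b' Gb'.
  by apply: nmin; apply/asboolP; exists b'.
have [Ab nb] := Gb.
have kill x : I x -> exists2 t, A t & x * b = d * t.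
  move=> Ix; have Ax := IA _ Ix.
  (* If x b qualifies, minimality puts b in x b A + d A, contradicting G b.
     Otherwise x b (1 - s) is 0 modulo d for some s in I; then b (1 - s)
     qualifies, and by minimality b is a multiple of it. *)
  have [G'|nG] := pselect (G (x * b)).
    have [||u [t [Au At E]]] := mu_min b (x * b) Ab _ _ (bmin _ G').
    - exact: AM.
    - by exists x, 0; split=> //; rewrite mulr0 addr0 mulrC.
    case: nb; exists (u * x), t; split=> //; first exact: IM.
    by rewrite [LHS]E; ring.
  have [s [t [Is At E]]] : exists s t, [/\ I s, A t & x * b = x * b * s + d * t].
    by apply: contrapT => h; apply: nG; split=> //; exact: AM.
  have As := IA _ Is; have A1s : A (1 - s) by apply: AD => //; exact: AN.
  have G' : G (b * (1 - s)).
    split=> [|[s' [t' [Is' At' E']]]]; first exact: AM.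
    apply: nb; exists (s + s' * (1 - s)), t'; split=> //.
      by apply: ID => //; rewrite mulrC; exact: IM.
    have {}E' : b * s + b * (1 - s) = b * s + (b * (1 - s) * s' + d * t').
      by congr (_ + _).
    by rewrite -mulrDr addrC subrK mulr1 in E'; rewrite [LHS]E'; ring.
  have [||u [t' [Au At' E']]] := mu_min b (b * (1 - s)) Ab _ _ (bmin _ G').
  - exact: AM.
  - by exists (1 - s), 0; split=> //; rewrite mulr0 addr0.
  exists (t * u + x * t'); first by apply: AD; exact: AM.
  have E2 : x * b * (1 - s) = d * t.
    by apply: (addrI (x * b * s)); rewrite -E; ring.
  by rewrite {1}E' mulrDr !mulrA E2; ring.
exists (b / d).
  by move=> Abd; apply: nb; exists 0, (b / d); split=> //; rewrite mulr0 add0r mulrC divfK.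
by move=> t /kill[t' At' E]; rewrite mulrAC [b * t]mulrC E mulrAC mulfV ?mul1r.
Qed.

Lemma ideal_inv_nonzero J : fractional_ideal A J ->
  exists2 x, ideal_inv A J x & x != 0.
Proof.
move=> [[n [g Jg]] _].
have /choice[d hd] i : exists d, [/\ A d, d != 0 & A (d * g i)].
  by have [d [Ad d0] Adg] := regular_denominator (g i); exists d.
exists (\prod_i d i); last by apply/prodf_neq0 => i _; have [] := hd i.
move=> y; rewrite Jg => -[a [Aa ->]]; rewrite mulr_sumr.
apply: (subring_sum regular_subring) => i _.
rewrite mulrCA; apply: regularM; first exact: Aa.
rewrite (bigD1 i) //= mulrAC mulrC; have [Ad _ Adg] := hd i.
apply: regularM => //; apply: big_ind => [||j _]; last by have [] := hd j.
  exact: (@regular1 F oo).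
exact: regularM.
Qed.

(** Were the product of J and its inverse a proper ideal, some x outside A
    would multiply it into A, hence stabilise the inverse of J. *)
Lemma ideal_inv_mul J : fractional_ideal A J -> ideal_mul (ideal_inv A J) J 1.
Proof.
move=> fJ; have [x0 ix0 x0n] := ideal_inv_nonzero fJ; have [fgJ [y0 Jy0 y0n]] := fJ.
have AD := @regularD F oo; have AM := @regularM F oo.
apply: contrapT => n1.
set I := ideal_mul _ _ in n1.
have Id : I (x0 * y0) by exact: module_prod_mem.
have IA : I `<=` A.
  apply: module_prod_ind => [||x y ix Jy]; [exact: (@regular0 F oo)|exact: AD|exact: ix].
have ID s t : I s -> I t -> I (s + t) by exact: module_prodD.
have IM a s : A a -> I s -> I (a * s).
  move=> Aa; move: s; apply: module_prod_ind => [|s t|x y ix Jy].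
  - by rewrite mulr0; exact: module_prod0.
  - by rewrite mulrDr; exact: ID.
  rewrite mulrA; apply: module_prod_mem => // z Jz.
  by rewrite -mulrA; apply: AM => //; exact: ix.
have [x nAx hx] := proper_ideal_colon (mulf_neq0 x0n y0n) Id IA n1 ID IM.
apply: nAx; apply: (@regular_closed (ideal_inv A J) y0 x0) => //.
  by move=> m im; rewrite mulrC; exact: im.
move=> m im y Jy; rewrite -mulrA; apply: hx; exact: module_prod_mem.
Qed.

Lemma fractional_ideal_inv J : fractional_ideal A J ->
  fractional_ideal A (ideal_inv A J).
Proof.
move=> fJ; split; last exact: ideal_inv_nonzero.
have [n [x [y [ix Jy E]]]] := ideal_inv_mul fJ.
exists n, x; apply/seteqP; split=> [z iz|z [a [Aa ->]] t Jt] /=.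
  exists (fun i => z * y i); split=> [i|]; first exact: iz.
  rewrite -[LHS]mulr1 E mulr_sumr; apply: eq_bigr => i _.
  by rewrite mulrAC mulrA.
rewrite mulr_suml; apply: (subring_sum regular_subring) => i _.
by rewrite -mulrA; apply: regularM => //; exact: ix.
Qed.

End Dedekind.

(** * Ultrametric fields *)

Lemma powers_unbounded (R : realType) (b M : R) : 1 < b -> exists n, M < b ^+ n.
Proof.
move=> b1; have h0 : 0 < b - 1 by rewrite subr_gt0.
have bern n : n%:R * (b - 1) <= b ^+ n.
  elim: n => [|n IH]; first by rewrite mul0r expr0.
  have b1n : 1 <= b ^+ n by rewrite exprn_ege1 // ltW.
  rewrite exprS -natr1; nra.
exists (Num.bound (`|M| / (b - 1))); apply: lt_le_trans (bern _).
rewrite -ltr_pdivrMr //; apply: le_lt_trans (archi_boundP _).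
  by rewrite ler_pM2r ?invr_gt0 // ler_norm.
by rewrite divr_ge0 // ltW.
Qed.

Lemma powers_small (R : realType) (b e : R) : 0 < b -> b < 1 -> 0 < e ->
  exists n, b ^+ n < e.
Proof.
move=> b0 b1 e0; have [|n hn] := @powers_unbounded R b^-1 e^-1.
  by rewrite invf_gt1.
by exists n; move: hn; rewrite exprVn ltf_pV2 // posrE ?exprn_gt0.
Qed.

Lemma exists_minimizer (R : realType) (T : eqType) (f : T -> R) (s : seq T) x0 :
  x0 \in s -> exists2 x, x \in s & forall y, y \in s -> f x <= f y.
Proof.
elim: s x0 => // a s IH x0 _; case: s IH => [_|b s IH].
  by exists a; rewrite ?mem_head // => y; rewrite inE => /eqP ->.
have [x xs xmin] := IH b (mem_head _ _).
have [le|lt] := leP (f a) (f x).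
  exists a; rewrite ?mem_head // => y; rewrite inE => /orP[/eqP -> //|ys].
  by apply: le_trans le _; exact: xmin.
exists x; first by rewrite inE xs orbT.
by move=> y; rewrite inE => /orP[/eqP ->|ys]; [exact: ltW|exact: xmin].
Qed.

Section Ultrametric.
Variables (R : realType) (C : fieldType) (abs : C -> R).

Record ultrametric_abs : Prop := UltrametricAbs {
  uabs_ge0 : forall z, 0 <= abs z;
  uabs_eq0 : forall z, abs z = 0 <-> z = 0;
  uabsM : forall z w, abs (z * w) = abs z * abs w;
  uabsD : forall z w, abs (z + w) <= Num.max (abs z) (abs w) }.

Hypothesis uabs : ultrametric_abs.

Let abs_ge0 := uabs_ge0 uabs.
Let absM := uabsM uabs.

Lemma uabs0 : abs 0 = 0. Proof. exact/(uabs_eq0 uabs). Qed.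

Lemma uabs_gt0 z : z != 0 -> 0 < abs z.
Proof.
move=> z0; rewrite lt_neqAle abs_ge0 andbT eq_sym.
by apply: contra_neq z0 => /(uabs_eq0 uabs).
Qed.

Lemma uabs1 : abs 1 = 1.
Proof.
have a1 : abs 1 != 0 by rewrite gt_eqF // uabs_gt0 ?oner_neq0.
by apply: (mulfI a1); rewrite -absM !mulr1.
Qed.

Lemma uabsN z : abs (- z) = abs z.
Proof.
rewrite -mulN1r absM; suff -> : abs (- 1) = 1 by rewrite mul1r.
have /eqP : abs (-1) * abs (-1) = 1 by rewrite -absM mulrNN mulr1 uabs1.
rewrite -expr2 sqrf_eq1 => /orP[/eqP //|/eqP h].
by have := abs_ge0 (-1); rewrite h oppr_ge0 ler10.
Qed.

Lemma uabsBC z w : abs (z - w) = abs (w - z).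
Proof. by rewrite -uabsN opprB. Qed.

Lemma uabsV z : abs z^-1 = (abs z)^-1.
Proof.
have [->|z0] := eqVneq z 0; first by rewrite invr0 uabs0 invr0.
have a0 : abs z != 0 by rewrite gt_eqF // uabs_gt0.
by apply: (mulfI a0); rewrite -absM !mulfV // uabs1.
Qed.

Lemma uabsX z n : abs (z ^+ n) = abs z ^+ n.
Proof. by elim: n => [|n IH]; rewrite ?expr0 ?uabs1 // !exprS absM IH. Qed.

Lemma uabs_prod (I : Type) (r : seq I) (P : pred I) (f : I -> C) :
  abs (\prod_(i <- r | P i) f i) = \prod_(i <- r | P i) abs (f i).
Proof. by elim/big_rec2: _ => [|i x y _ <-]; rewrite ?uabs1 ?absM. Qed.

Lemma uabsD_le z w M : abs z <= M -> abs w <= M -> abs (z + w) <= M.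
Proof. by move=> hz hw; apply: le_trans (uabsD uabs _ _) _; rewrite ge_max hz hw. Qed.

Lemma uabsD_lt z w M : abs z < M -> abs w < M -> abs (z + w) < M.
Proof. by move=> hz hw; apply: le_lt_trans (uabsD uabs _ _) _; rewrite gt_max hz hw. Qed.

Lemma uabsB_le z w M : abs z <= M -> abs w <= M -> abs (z - w) <= M.
Proof. by move=> hz hw; apply: uabsD_le; rewrite ?uabsN. Qed.

Lemma uabs_dom z w : abs w < abs z -> abs (z + w) = abs z.
Proof.
move=> lt; apply/eqP; rewrite eq_le uabsD_le ?(ltW lt) //= leNgt; apply/negP => h.
have : abs (z + w - w) < abs z by apply: uabsD_lt; rewrite ?uabsN.
by rewrite addrK ltxx.
Qed.

Lemma uabs_close z w : abs (z - w) < abs w -> abs z = abs w.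
Proof. by move=> /uabs_dom; rewrite addrC subrK. Qed.

(** Ultrametric errors do not accumulate: the worst factor alone decides,
    whatever the number of factors. *)
Lemma uabs_prod_near1 (I : eqType) (r : seq I) (P : pred I) (f : I -> C) e : e <= 1 ->
  0 <= e -> (forall i, i \in r -> P i -> abs (f i - 1) <= e) ->
  abs (\prod_(i <- r | P i) f i - 1) <= e.
Proof.
move=> e1 e0; elim: r => [|i r IH] h; first by rewrite big_nil subrr uabs0.
have {}IH : abs (\prod_(j <- r | P j) f j - 1) <= e.
  by apply: IH => j jr; apply: h; rewrite inE jr orbT.
rewrite big_cons; case: ifPn => // Pi; have fi := h i (mem_head _ _) Pi.
set p := \prod_(_ <- _ | _) _ in IH *.
rewrite (_ : f i * p - 1 = (f i - 1) * p + (p - 1)); last by ring.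
apply: uabsD_le => //; rewrite absM -[leRHS]mulr1 ler_pM //.
by rewrite -[p](subrK 1); apply: uabsD_le; rewrite ?uabs1 // (le_trans IH).
Qed.

Lemma uabs_prod_near (I : eqType) (r : seq I) (P : pred I) (f g : I -> C) B e :
  1 <= B -> 0 <= e ->
  (forall i, i \in r -> P i -> [/\ abs (f i) <= B, abs (g i) <= B & abs (f i - g i) <= e]) ->
  abs (\prod_(i <- r | P i) f i - \prod_(i <- r | P i) g i) <= B ^+ size r * e /\
  abs (\prod_(i <- r | P i) f i) <= B ^+ size r.
Proof.
move=> B1 e0; have B0 : 0 <= B by apply: le_trans B1.
elim: r => [|i r IH] h; first by rewrite !big_nil subrr uabs0 expr0 mul1r uabs1.
have [{}IH IHf] := IH (fun j jr => h j (@mem_behead _ (i :: r) j jr)).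
rewrite !big_cons; set p := \prod_(_ <- _ | _) _ in IH IHf *.
set q := \prod_(_ <- _ | _) _ in IH IHf *.
have Bn : 0 <= B ^+ size r by rewrite exprn_ge0.
have le : B ^+ size r <= B ^+ size (i :: r) by rewrite exprS ler_peMl.
case: ifPn => Pi; last first.
  by split; [apply: le_trans IH _; rewrite ler_wpM2r|exact: le_trans le].
have [fB gB fg] := h i (mem_head _ _) Pi; split; last first.
  by rewrite absM /= exprS ler_pM.
rewrite (_ : f i * p - g i * q = (f i - g i) * p + g i * (p - q)); last by ring.
apply: uabsD_le; rewrite absM.
  by rewrite mulrC; apply: ler_pM => //; exact: le_trans IHf le.
by rewrite /= exprS -mulrA; apply: ler_pM.
Qed.

(** * Exponential functions of lattices *)

Record discrete_group (L : set C) : Prop := DiscreteGroup {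
  group0 : L 0;
  groupB : forall z w, L z -> L w -> L (z - w);
  group_discrete : forall rho : R, finite_set (L `&` [set z | abs z <= rho]) }.

Lemma groupN L z : discrete_group L -> L z -> L (- z).
Proof. by move=> gL Lz; rewrite -sub0r; apply: groupB => //; exact: group0. Qed.

Lemma groupD L z w : discrete_group L -> L z -> L w -> L (z + w).
Proof.
by move=> gL Lz Lw; rewrite -[w]opprK; apply: groupB => //; exact: groupN.
Qed.

Definition lball (L : set C) (rho : R) : seq C :=
  finmap.enum_fset (fset_set (L `&` [set z | abs z <= rho])).

Definition lprod (L : set C) (rho : R) (z : C) : C :=
  z * \prod_(l <- lball L rho | l != 0) (1 - z / l).

Definition monic_lprod (L : set C) (rho : R) (z : C) : C :=
  \prod_(l <- lball L rho) (z - l).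

Section OneLattice.
Variables (L : set C) (gL : discrete_group L).

Lemma lballP rho l : reflect (L l /\ abs l <= rho) (l \in lball L rho).
Proof.
rewrite /lball in_fset_set; last exact: group_discrete.
by rewrite in_setI; apply: (iffP andP) => -[]; rewrite !inE.
Qed.

Lemma lball_uniq rho : uniq (lball L rho).
Proof. exact: finmap.fset_uniq. Qed.

Lemma lball0 rho : 0 <= rho -> 0 \in lball L rho.
Proof. by move=> h; apply/lballP; rewrite uabs0; split=> //; exact: group0. Qed.

Lemma lattice_exp_partialE z n : lattice_exp_partial abs L z n = lprod L n%:R z.
Proof.
rewrite /lattice_exp_partial /lprod; congr (_ * _).
pose r := [seq l <- lball L n%:R | l != 0]; rewrite -[RHS]big_filter -/r.
have memr l : (l \in r) = (l \in [set l | [/\ L l, l != 0 & abs l <= n%:R]]).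
  rewrite mem_filter; apply/andP/idP; rewrite inE.
    by move=> [l0 /lballP[]].
  by move=> [Ll l0 ln]; split=> //; apply/lballP.
rewrite (@fsbigE _ _ _ _ _ r) ?filter_uniq ?lball_uniq //.
- by rewrite big_seq_cond [RHS]big_seq; apply: eq_bigl => l; rewrite memr andbb.
- by move=> l /=; rewrite memr inE.
by move=> l hl; rewrite memr => /negP; rewrite inE.
Qed.

Lemma monic_lprodE rho z : 0 <= rho ->
  lprod L rho z = (\prod_(l <- lball L rho | l != 0) (- l^-1)) * monic_lprod L rho z.
Proof.
move=> h; rewrite /monic_lprod (bigD1_seq 0) ?lball0 ?lball_uniq //= subr0 mulrCA.
rewrite /lprod -big_split; congr (_ * _); apply: eq_bigr => l l0.
by rewrite /= mulrBr !mulNr opprK mulVf // addrC mulrC.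
Qed.

Lemma lball_shift rho l : l \in lball L rho ->
  perm_eq (lball L rho) [seq u - l | u <- lball L rho].
Proof.
move=> /lballP[Ll lr]; apply: uniq_perm; rewrite ?lball_uniq //.
  by rewrite map_inj_uniq ?lball_uniq //; exact: subIr.
move=> u; apply/idP/mapP => [/lballP[Lu ur]|[w /lballP[Lw wr] ->]].
  exists (u + l); last by rewrite addrK.
  by apply/lballP; split; [exact: groupD|exact: uabsD_le].
by apply/lballP; split; [exact: groupB|exact: uabsB_le].
Qed.

Lemma monic_lprod_shift rho z l : l \in lball L rho ->
  monic_lprod L rho (z + l) = monic_lprod L rho z.
Proof.
move=> hl; rewrite {2}/monic_lprod (perm_big _ (lball_shift hl)) big_map.
by apply: eq_bigr => u _; rewrite opprB addrA addrAC.
Qed.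

Lemma monic_lprod0 rho l : l \in lball L rho -> monic_lprod L rho l = 0.
Proof.
by move=> hl; rewrite /monic_lprod (bigD1_seq l) ?lball_uniq //= subrr mul0r.
Qed.

(** For fixed y, the difference of the two sides is a polynomial in x of degree
    less than the order of the group, since the leading terms cancel, and it
    vanishes on the group. *)
Lemma monic_lprod_additive rho x y : 0 <= rho ->
  monic_lprod L rho (x + y) = monic_lprod L rho x + monic_lprod L rho y.
Proof.
move=> rho0; pose s := lball L rho.
pose q a : {poly C} := \prod_(l <- s) ('X - (l - a)%:P).
have qE a z : (q a).[z] = monic_lprod L rho (z + a).
  rewrite /q horner_prod; apply: eq_bigr => l _.
  by rewrite hornerXsubC opprB addrA addrAC.
have sq a : size (q a) = (size s).+1.
  rewrite /q -(big_map (fun l => l - a) xpredT (fun l => 'X - l%:P)).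
  by rewrite size_prod_XsubC size_map.
have lq a : (q a)`_(size s) = 1.
  have /monicP : q a \is monic by apply: monic_prod => l _; exact: monicXsubC.
  by rewrite lead_coefE sq.
have s0 : (0 < size s)%N by rewrite -has_predT; apply/hasP; exists 0; rewrite ?lball0.
pose p := q y - q 0 - (monic_lprod L rho y)%:P.
suff p0 : p = 0.
  have := congr1 (horner^~ x) p0; rewrite /p !hornerE !qE addr0 => /eqP.
  by rewrite subr_eq0 subr_eq => /eqP ->; exact: addrC.
apply/eqP/negPn/negP => pn0.
have := max_poly_roots pn0 (_ : all (root p) s) (lball_uniq rho).
rewrite ltnNge => /(_ _)/negP; apply.
  apply/allP => l ls; apply/rootP; rewrite /p !hornerE !qE addr0.
  by rewrite (monic_lprod0 ls) subr0 [l + y]addrC monic_lprod_shift // subrr.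
apply/leq_sizeP => j; rewrite leq_eqVlt => /orP[/eqP <-|lt].
  by rewrite !coefB !lq subrr sub0r coefC gtn_eqF // oppr0.
by rewrite !coefB coefC gtn_eqF ?(ltn_trans s0 lt) // !nth_default ?sq // !subr0.
Qed.

(** ** Convergence *)

(** The estimate is uniform in sigma: it yields both the convergence of the
    infinite product and its rate. *)
Lemma lprod_tail rho sigma z : 0 < rho -> rho <= sigma -> abs z <= rho ->
  exists2 t, lprod L sigma z = lprod L rho z * t & abs (t - 1) <= abs z / rho.
Proof.
move=> rho0 le zr; pose near l := abs l <= rho.
exists (\prod_(l <- lball L sigma | (l != 0) && ~~ near l) (1 - z / l)).
  rewrite /lprod -mulrA (bigID near) /=; congr (_ * (_ * _)).
  rewrite -big_filter -[RHS]big_filter; apply: perm_big; apply: uniq_perm.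
  - by rewrite filter_uniq ?lball_uniq.
  - by rewrite filter_uniq ?lball_uniq.
  move=> l; rewrite !mem_filter; apply/andP/andP => -[].
    by move=> /andP[l0 nl] /lballP[Ll _]; split=> //; apply/lballP.
  move=> l0 /lballP[Ll lr]; split; first by rewrite l0 /near lr.
  by apply/lballP; split=> //; exact: le_trans lr le.
apply: uabs_prod_near1 => [||l _ /andP[l0 far]].
- by rewrite ler_pdivrMr // mul1r.
- by rewrite divr_ge0 // ltW.
rewrite addrC addKr uabsN absM uabsV ler_wpM2l // lef_pV2 ?posrE ?uabs_gt0 //.
by rewrite ltW // ltNge.
Qed.

Lemma lprod_abs rho sigma z : 0 < rho -> rho <= sigma -> abs z < rho ->
  abs (lprod L sigma z) = abs (lprod L rho z).
Proof.
move=> rho0 le zr; have [t -> t1] := lprod_tail rho0 le (ltW zr).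
rewrite absM (@uabs_close t 1) ?uabs1 ?mulr1 //.
by apply: le_lt_trans t1 _; rewrite ltr_pdivrMr // mul1r.
Qed.

Lemma lprod_step rho sigma z : 0 < rho -> rho <= sigma -> abs z <= rho ->
  abs (lprod L sigma z - lprod L rho z) <= abs (lprod L rho z) * (abs z / rho).
Proof.
move=> rho0 le zr; have [t -> t1] := lprod_tail rho0 le zr.
by rewrite -{2}[lprod L rho z]mulr1 -mulrBr absM ler_wpM2l.
Qed.

Hypothesis complete : forall u, cauchy_seq abs u -> exists l, converges abs u l.

Local Notation E := (lattice_exp abs L).

Lemma lattice_exp_cvg z : converges abs (lattice_exp_partial abs L z) (E z).
Proof.
apply: (@xgetPex _ 0 [set w | converges abs (lattice_exp_partial abs L z) w]).
apply: complete => eps eps0.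
pose rho := abs z + 1; have rho0 : 0 < rho by rewrite ltr_wpDl.
have zr : abs z < rho by rewrite ltrDl.
pose M := abs (lprod L rho z); have M0 : 0 <= M by exact: abs_ge0.
have MZ : 0 <= M * abs z / eps by apply: divr_ge0; [exact: mulr_ge0|exact: ltW].
pose N := Num.bound (rho + M * abs z / eps).
have N0 : rho + M * abs z / eps < N%:R.
  by apply: archi_boundP; apply: addr_ge0 => //; exact: ltW.
have N1 : rho < N%:R by apply: le_lt_trans N0; rewrite lerDl.
have half m n : (N <= m)%N -> (m <= n)%N ->
    abs (lprod L n%:R z - lprod L m%:R z) < eps.
  move=> Nm mn; have rm : rho < m%:R by apply: lt_le_trans N1 _; rewrite ler_nat.
  have m0 : (0 : R) < m%:R by exact: lt_trans rm.
  apply: le_lt_trans (lprod_step m0 _ (ltW (lt_trans zr rm))) _.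
    by rewrite ler_nat.
  rewrite (lprod_abs rho0 (ltW rm) zr) -/M mulrA ltr_pdivrMr //.
  rewrite -ltr_pdivrMl // mulrC; apply: (@lt_le_trans _ _ N%:R); last by rewrite ler_nat.
  by apply: le_lt_trans N0; rewrite lerDr ltW.
exists N => m n Nm Nn; rewrite !lattice_exp_partialE.
by have [mn|nm] := leqP m n; [rewrite uabsBC|]; apply: half => //; exact: ltnW.
Qed.

Lemma lattice_exp_approx rho z : 0 < rho -> abs z <= rho ->
  abs (E z - lprod L rho z) <= abs (lprod L rho z) * (abs z / rho).
Proof.
move=> rho0 zr; rewrite leNgt; apply/negP => lt.
have [|N hN] := lattice_exp_cvg z (eps := abs (E z - lprod L rho z)).
  by apply: le_lt_trans lt; rewrite mulr_ge0 // divr_ge0 // ltW.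
pose n := maxn N (Num.bound rho).
have rn : rho <= n%:R.
  by apply: le_trans (ltW (archi_boundP (ltW rho0))) _; rewrite ler_nat leq_maxr.
have h1 := hN n (leq_maxl _ _); rewrite lattice_exp_partialE uabsBC in h1.
have h2 := le_lt_trans (lprod_step rho0 rn zr) lt.
by have := uabsD_lt h1 h2; rewrite addrA subrK ltxx.
Qed.

Lemma lattice_exp_abs rho z : abs z < rho -> abs (E z) = abs (lprod L rho z).
Proof.
move=> zr; have rho0 : 0 < rho by exact: le_lt_trans zr.
have := lattice_exp_approx rho0 (ltW zr).
have [p0|p0] := eqVneq (lprod L rho z) 0.
  rewrite p0 uabs0 mul0r subr0 => h; apply/eqP; rewrite eq_le h /=.
  exact: abs_ge0.
move=> h; apply: uabs_close; apply: le_lt_trans h _.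
by rewrite gtr_pMr ?uabs_gt0 // ltr_pdivrMr // mul1r.
Qed.

Lemma lattice_exp_zero l : L l -> E l = 0.
Proof.
move=> Ll; apply/(uabs_eq0 uabs); rewrite (@lattice_exp_abs (abs l + 1)) ?ltrDl //.
rewrite monic_lprodE; last by rewrite addr_ge0.
by rewrite monic_lprod0 ?mulr0 ?uabs0 //; apply/lballP; rewrite lerDl.
Qed.

(** No factor other than z itself changes the absolute value of a short z. *)
Lemma lattice_exp_small z m : (forall l, L l -> l != 0 -> m <= abs l) -> abs z < m ->
  abs (E z) = abs z.
Proof.
move=> hm zm; rewrite (lattice_exp_abs zm) absM uabs_prod big_seq_cond big1 ?mulr1 //.
move=> l /andP[/lballP[Ll _] l0].
rewrite -[RHS]uabs1; apply: uabs_dom; rewrite uabsN absM uabsV uabs1.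
by rewrite ltr_pdivrMr ?uabs_gt0 // mul1r; apply: lt_le_trans zm (hm _ Ll l0).
Qed.

Lemma lattice_exp_bounded s : exists M, forall z, abs z <= s -> abs (E z) <= M.
Proof.
have [s0|s0] := ltP s 0.
  by exists 0 => z zs; have := le_lt_trans (le_trans (abs_ge0 z) zs) s0; rewrite ltxx.
exists (s * \prod_(l <- lball L (s + 1) | l != 0) Num.max 1 (s / abs l)) => z zs.
rewrite (@lattice_exp_abs (s + 1)); last by apply: le_lt_trans zs _; rewrite ltrDl.
rewrite absM uabs_prod ler_pM // ?prodr_ge0 //.
apply: ler_prod => l l0; rewrite abs_ge0 /=; apply: le_trans (uabsD uabs _ _) _.
rewrite uabs1 uabsN absM uabsV ge_max !le_max lexx /=.
by apply/orP; right; rewrite ler_pM2r // invr_gt0 uabs_gt0.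
Qed.

(** The distance to the lattice is bounded by the exponential function: after
    moving z by a nearest lattice point, no factor is less than 1. *)
Lemma lattice_exp_dist z : exists2 l, L l & abs (z - l) <= abs (E z).
Proof.
pose rho := abs z + 1; have rho0 : 0 < rho by rewrite ltr_wpDl.
have zr : abs z < rho by rewrite ltrDl.
have [l0 /[dup] l0b /lballP[Ll0 l0r] l0min] :=
  exists_minimizer (fun l => abs (z - l)) (lball0 (ltW rho0)).
exists l0 => //; have rho0' := ltW rho0; rewrite (lattice_exp_abs zr) monic_lprodE //.
rewrite -[z in leRHS](subrK l0) monic_lprod_shift // -monic_lprodE // absM uabs_prod.
rewrite ler_peMr // big_seq_cond; elim/big_ind: _ => // [x y x1 y1|l].
  by rewrite -[1]mulr1 ler_pM.
move=> /andP[/lballP[Ll lr] l_n0].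
rewrite -(ler_pM2r (uabs_gt0 l_n0)) -absM mulrBl !mul1r divfK // uabsBC.
have le1 : abs (z - l0) <= abs (z - l0 - l).
  rewrite -addrA -opprD; apply: l0min; apply/lballP.
  by split; [exact: groupD|exact: uabsD_le].
rewrite -[X in abs X <= _](subrK (z - l0)); apply: uabsD_le; first by rewrite uabsBC.
by [].
Qed.

(** ** The functional equation *)

Lemma lprod_const_neq0 rho : \prod_(l <- lball L rho | l != 0) (- l^-1) != 0 :> C.
Proof.
apply: (big_ind (fun x : C => x != 0)) => [|x y|l l0]; first exact: oner_neq0.
  exact: mulf_neq0.
by rewrite oppr_eq0 invr_eq0.
Qed.

(** L / a L being finite, the product for a L at a z is a product of translates
    of the product for L at z, and each of these is a translate by additivity. *)
Lemma lprod_functional (T : finType) (rep : T -> C) (a : C) rho :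
  a != 0 -> 0 <= rho -> (forall l, L l -> L (a * l)) ->
  (forall l, L l -> exists2 t, (exists2 l', L l' & l - rep t = a * l') &
      forall t', (exists2 l', L l' & l - rep t' = a * l') -> t' = t) ->
  exists2 phi : {poly C}, (size phi <= #|T|.+1)%N &
    forall z, lprod L (rho * abs a) (a * z) = phi.[lprod L rho z].
Proof.
move=> a0 rho0 aL hrep; have aa0 := uabs_gt0 a0.
have arho0 : 0 <= rho * abs a by rewrite mulr_ge0.
have /choice[cl hcl] l : exists t, L l -> (exists2 l', L l' & l - rep t = a * l') /\
    forall t', (exists2 l', L l' & l - rep t' = a * l') -> t' = t.
  have [Ll|nL] := pselect (L l); first by have [t h1 h2] := hrep l Ll; exists t.
  have [t _ _] := hrep 0 (group0 gL); by exists t.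
have clE l u : L l -> L u -> (exists2 l', L l' & l = u + a * l') -> cl l = cl u.
  move=> Ll Lu [l' Ll' E]; have [[u' Lu' Eu] _] := hcl u Lu; have [_ h] := hcl l Ll.
  apply/esym/h; exists (u' + l'); first exact: groupD.
  by rewrite E addrAC Eu mulrDr.
pose kap := \prod_(l <- lball L rho | l != 0) (- l^-1) : C.
have kap0 : kap != 0 := lprod_const_neq0 rho.
pose V := lball L (rho * abs a).
have /choice[psi hpsi] t : exists psi : {poly C}, (size psi <= 2)%N /\
    forall z, \prod_(v <- V | cl v == t) (a * z - v) = psi.[lprod L rho z].
  have [/hasP[u uV /eqP ut]|none] := boolP (has (fun v => cl v == t) V); last first.
    exists 1; rewrite size_poly1; split=> // z; rewrite hornerE big_seq_cond big1 // => v.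
    by move=> /andP[vV vt]; case/hasP: none; exists v.
  have [Lu ur] := lballP _ _ uV.
  pose N := size (lball L rho).
  exists (a ^+ N *: (kap^-1 *: 'X - (monic_lprod L rho (u / a))%:P)); split.
    apply: leq_trans (size_scale_leq _ _) _; apply: leq_trans (size_polyD _ _) _.
    rewrite geq_max size_polyN size_polyC (leq_trans (size_scale_leq _ _)) ?size_polyX //.
    by case: (_ != 0).
  move=> z; rewrite -big_filter hornerZ hornerD hornerN hornerC hornerZ hornerX.
  rewrite (monic_lprodE z rho0) -/kap mulKf //.
  have -> : monic_lprod L rho z - monic_lprod L rho (u / a) = monic_lprod L rho (z - u / a).
    by apply/eqP; rewrite subr_eq -monic_lprod_additive // subrK.
  transitivity (\prod_(w <- lball L rho) (a * (z - u / a - w))); last first.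
    by rewrite big_split /= big_const_seq count_predT iter_mulr_1.
  rewrite (perm_big [seq u + a * w | w <- lball L rho]); last first.
    apply: uniq_perm; first by rewrite filter_uniq ?lball_uniq.
      by rewrite map_inj_uniq ?lball_uniq // => w w' /addrI /(mulfI a0).
    move=> v; rewrite mem_filter; apply/andP/mapP.
      move=> [/eqP vt /lballP[Lv vr]].
      have [[u' Lu' Eu] _] := hcl u Lu; have [[v' Lv' Ev] _] := hcl v Lv.
      have vE : v = u + a * (v' - u').
        by rewrite mulrBr -Ev -Eu vt ut; ring.
      exists (v' - u') => //; apply/lballP; split; first exact: groupB.
      rewrite -(ler_pM2r aa0) mulrC -absM (_ : a * _ = v - u); last by rewrite vE; ring.
      exact: uabsB_le.
    move=> [w /lballP[Lw wr] ->]; have Laux : L (u + a * w) by apply: groupD => //; exact: aL.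
    split; first by apply/eqP; rewrite -ut; apply: clE => //; exists w.
    apply/lballP; split=> //; apply: uabsD_le => //.
    by rewrite absM mulrC ler_wpM2r.
  rewrite big_map; apply: eq_bigr => w _.
  by rewrite !mulrBr mulrCA mulfV // mulr1; ring.
exists ((\prod_(l <- V | l != 0) (- l^-1)) *: \prod_t psi t).
  apply: leq_trans (size_scale_leq _ _) _; apply: leq_trans (size_poly_prod_leq _ _) _.
  rewrite leq_subLR; apply: (@leq_trans (#|T| * 2).+1).
    rewrite ltnS -sum_nat_const; apply: leq_sum => t _; by have [] := hpsi t.
  by rewrite muln2 -addnn addnS.
move=> z; rewrite monic_lprodE // hornerZ; congr (_ * _).
rewrite /monic_lprod (partition_big cl xpredT) //= horner_prod.
by apply: eq_bigr => t _; have [_ ->] := hpsi t.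
Qed.

End OneLattice.

(** * Lagrange interpolation *)

Definition lagrange_eval N (x y : 'I_N -> C) (X : C) : C :=
  \sum_i y i * \prod_(j | j != i) ((X - x j) / (x i - x j)).

Lemma lagrange_evalE N (x : 'I_N -> C) (phi : {poly C}) X : injective x ->
  (size phi <= N)%N -> phi.[X] = lagrange_eval x (fun i => phi.[x i]) X.
Proof.
move=> injx sphi.
pose b i : {poly C} := \prod_(j | j != i) ((x i - x j)^-1 *: ('X - (x j)%:P)).
pose p := \sum_i phi.[x i] *: b i.
have pE Y : p.[Y] = lagrange_eval x (fun i => phi.[x i]) Y.
  rewrite /p horner_sum; apply: eq_bigr => i _; rewrite hornerZ horner_prod.
  congr (_ * _); apply: eq_bigr => j _.
  by rewrite hornerZ hornerXsubC mulrC.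
rewrite -pE; suff : phi - p = 0 by move/eqP; rewrite subr_eq0 => /eqP <-.
apply/eqP/negPn/negP => n0.
have uniqx : uniq [seq x i | i <- enum 'I_N] by rewrite map_inj_uniq ?enum_uniq.
have := max_poly_roots n0 _ uniqx.
rewrite size_map size_enum_ord ltnNge => /(_ _)/negP; apply.
  apply/allP => _ /mapP[k _ ->]; apply/rootP; rewrite hornerD hornerN pE.
  rewrite /lagrange_eval (bigD1 k) //= [X in _ * X]big1 => [|j jk]; last first.
    by rewrite divff // subr_eq0; apply: contra_neq jk => /injx.
  rewrite mulr1 big1 ?addr0 ?subrr // => i ik.
  by rewrite (bigD1 k) 1?eq_sym //= subrr mul0r mul0r mulr0.
apply: leq_trans (size_polyD _ _) _; rewrite geq_max sphi size_polyN.
apply: leq_trans (size_sum _ _ _) _; apply/bigmax_leqP => i _.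
apply: leq_trans (size_scale_leq _ _) _; apply: leq_trans (size_poly_prod_leq _ _) _.
rewrite leq_subLR; apply: (@leq_trans (#|predC1 i| * 2).+1).
  rewrite ltnS -sum_nat_const; apply: leq_sum => j _.
  by apply: leq_trans (size_scale_leq _ _) _; rewrite size_XsubC.
have : (0 < N)%N by apply: leq_ltn_trans (ltn_ord i).
by rewrite cardC1 card_ord; lia.
Qed.

(** * Approximation along a filter *)

Section Approximately.
Variables (T : Type) (G : set_system T).
Context {FG : Filter G}.

Definition null (u : T -> C) : Prop :=
  forall e : R, 0 < e -> G [set t | abs (u t) < e].

(** Closeness of bounded functions which need not converge: uniformity in an
    auxiliary argument is obtained by making it part of t. *)
Definition approx (u v : T -> C) : Prop :=
  (exists M, G [set t | abs (v t) <= M]) /\ null (fun t => u t - v t).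

Definition bounded_below (v : T -> C) : Prop :=
  exists2 m : R, 0 < m & G [set t | m <= abs (v t)].

Lemma approx_bounded u v : approx u v ->
  exists2 M, 0 < M & G [set t | abs (u t) <= M /\ abs (v t) <= M].
Proof.
move=> [[M vM] uv]; exists (Num.max M 1); first by rewrite lt_max ltr01 orbT.
apply: filterS (filterI vM (uv 1 ltr01)) => t /= [vt ut].
split; last by rewrite le_max vt.
by rewrite -[u t](subrK (v t)) uabsD_le // le_max ?vt // (ltW ut) orbT.
Qed.

Lemma approx_cst c : approx (fun=> c) (fun=> c).
Proof.
split; first by exists (abs c); apply: filterS filterT => t _ /=.
by move=> e e0; apply: filterS filterT => t _ /=; rewrite subrr uabs0.
Qed.

Lemma approxD u v u' v' : approx u u' -> approx v v' ->
  approx (fun t => u t + v t) (fun t => u' t + v' t).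
Proof.
move=> [[M uM] hu] [[M' vM] hv]; split.
  exists (Num.max M M'); apply: filterS (filterI uM vM) => t /= [ut vt].
  by apply: uabsD_le; rewrite le_max ?ut ?vt ?orbT.
move=> e e0; apply: filterS (filterI (hu e e0) (hv e e0)) => t /= [ut vt].
by rewrite opprD addrACA; exact: uabsD_lt.
Qed.

Lemma approxN u v : approx u v -> approx (fun t => - u t) (fun t => - v t).
Proof.
move=> [[M uM] hu]; split.
  by exists M; apply: filterS uM => t /=; rewrite uabsN.
by move=> e e0; apply: filterS (hu e e0) => t /=; rewrite -opprD uabsN.
Qed.

Lemma approxB u v u' v' : approx u u' -> approx v v' ->
  approx (fun t => u t - v t) (fun t => u' t - v' t).
Proof. by move=> hu /approxN; exact: approxD. Qed.

Lemma approxM u v u' v' : approx u u' -> approx v v' ->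
  approx (fun t => u t * v t) (fun t => u' t * v' t).
Proof.
move=> hu hv; have [M M0 uM] := approx_bounded hu; have [M' M'0 vM] := approx_bounded hv.
split.
  exists (M * M'); apply: filterS (filterI uM vM) => t /= [[_ ut] [_ vt]].
  by rewrite absM ler_pM.
move=> e e0; have eM : 0 < e / M by rewrite divr_gt0.
have eM' : 0 < e / M' by rewrite divr_gt0.
apply: filterS (filterI (filterI uM vM) (filterI (hu.2 _ eM') (hv.2 _ eM))) => t /=.
move=> [[[ut u't] [vt v't]] [du dv]].
rewrite (_ : _ - _ = (u t - u' t) * v t + u' t * (v t - v' t)); last by ring.
apply: uabsD_lt; rewrite absM.
  apply: le_lt_trans (ler_wpM2l (abs_ge0 _) vt) _.
  by rewrite -ltr_pdivlMr.
apply: le_lt_trans (ler_wpM2r (abs_ge0 _) u't) _.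
by rewrite mulrC -ltr_pdivlMr.
Qed.

Lemma approx_bounded_below u v : approx u v -> bounded_below v ->
  exists2 m : R, 0 < m & G [set t | m <= abs (v t) /\ abs (u t) = abs (v t)].
Proof.
move=> [_ huv] [m m0 vm]; exists m => //.
apply: filterS (filterI vm (huv m m0)) => t /= [vt ut]; split=> //.
exact/uabs_close/(lt_le_trans ut).
Qed.

Lemma approxV u v : approx u v -> bounded_below v ->
  approx (fun t => (u t)^-1) (fun t => (v t)^-1).
Proof.
move=> huv vm; have [m m0 uvm] := approx_bounded_below huv vm; split.
  exists m^-1; apply: filterS uvm => t /= [vt _].
  by rewrite uabsV lef_pV2 // posrE (lt_le_trans m0).
move=> e e0; have em : 0 < e * (m * m) by rewrite !mulr_gt0.
apply: filterS (filterI uvm (huv.2 _ em)) => t /= [[vt ut] d].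
have nz z : m <= abs z -> z != 0.
  by move=> mz; apply: contraTneq mz => ->; rewrite uabs0 -ltNge.
have v0 := nz _ vt; have u0 : u t != 0 by apply: nz; rewrite ut.
rewrite (_ : _ - _ = - (u t - v t) / (u t * v t)).
  rewrite absM uabsN uabsV absM ut ltr_pdivrMr ?mulr_gt0 ?uabs_gt0 //.
  by apply: lt_le_trans d _; rewrite ler_pM2l // ler_pM // ltW.
by field; rewrite u0 v0.
Qed.

Lemma approx_sum (I : Type) (r : seq I) (P : pred I) (u v : I -> T -> C) :
  (forall i, P i -> approx (u i) (v i)) ->
  approx (fun t => \sum_(i <- r | P i) u i t) (fun t => \sum_(i <- r | P i) v i t).
Proof.
move=> h; elim: r => [|i r IH].
  under eq_fun do rewrite big_nil.
  by under [X in approx _ X]eq_fun do rewrite big_nil; exact: approx_cst.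
under eq_fun do rewrite big_cons.
under [X in approx _ X]eq_fun do rewrite big_cons.
by case Pi : (P i) => //; apply: approxD => //; exact: h.
Qed.

Lemma approx_prod (I : Type) (r : seq I) (P : pred I) (u v : I -> T -> C) :
  (forall i, P i -> approx (u i) (v i)) ->
  approx (fun t => \prod_(i <- r | P i) u i t) (fun t => \prod_(i <- r | P i) v i t).
Proof.
move=> h; elim: r => [|i r IH].
  under eq_fun do rewrite big_nil.
  by under [X in approx _ X]eq_fun do rewrite big_nil; exact: approx_cst.
under eq_fun do rewrite big_cons.
under [X in approx _ X]eq_fun do rewrite big_cons.
by case Pi : (P i) => //; apply: approxM => //; exact: h.
Qed.

Lemma approx_lagrange N (x y x' y' : 'I_N -> T -> C) (X X' : T -> C) :
  (forall i, approx (x i) (x' i)) -> (forall i, approx (y i) (y' i)) -> approx X X' ->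
  (forall i j, j != i -> bounded_below (fun t => x' i t - x' j t)) ->
  approx (fun t => lagrange_eval (x^~ t) (y^~ t) (X t))
         (fun t => lagrange_eval (x'^~ t) (y'^~ t) (X' t)).
Proof.
move=> hx hy hX sep; apply: approx_sum => i _; apply: approxM => //.
apply: approx_prod => j ji; apply: approxM; first exact: approxB.
by apply: approxV; [exact: approxB|exact: sep].
Qed.

End Approximately.

Definition at_infinity : set_system R :=
  [set A | exists rho0, forall rho, rho0 <= rho -> A rho].

Instance at_infinity_filter : Filter at_infinity.
Proof.
split=> [|A B [r hA] [s hB]|A B AB [r hA]].
- by exists 0.
- by exists (Num.max r s) => t; rewrite ge_max => /andP[rt st]; split; [exact: hA|exact: hB].
by exists r => t rt; apply: AB; exact: hA.
Qed.

Section Uniform.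
Hypothesis complete : forall u, cauchy_seq abs u -> exists l, converges abs u l.

Local Notation E := (lattice_exp abs).

Lemma lprod_approx L z : discrete_group L ->
  approx at_infinity (fun rho => lprod L rho z) (fun=> E L z).
Proof.
move=> gL; split; first by exists (abs (E L z)), 0 => rho _ /=.
move=> e e0; exists (abs z + 1 + abs (E L z) * abs z / e) => rho hrho /=.
have Ee : 0 <= abs (E L z) * abs z / e.
  by apply: divr_ge0; [exact: mulr_ge0|exact: ltW].
have zr : abs z + 1 <= rho by apply: le_trans hrho; rewrite lerDl.
have rho1 : abs z < rho by apply: lt_le_trans zr; rewrite ltrDl.
have rho0 : 0 < rho by exact: le_lt_trans rho1.
rewrite uabsBC; apply: le_lt_trans (lattice_exp_approx gL complete rho0 (ltW rho1)) _.
rewrite -(lattice_exp_abs gL complete rho1) mulrA ltr_pdivrMr //.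
rewrite -ltr_pdivrMl // mulrC; apply: lt_le_trans hrho.
by rewrite ltrDr ltr_wpDl.
Qed.

(** The point is the bound N on the size of phi: it does not depend on rho, and
    will be the same for all lattices of bounded rank. *)
Definition functional_equation N (a : C) (L : set C) : Prop :=
  forall rho, 0 < rho -> exists2 phi : {poly C}, (size phi <= N)%N &
    forall z, lprod L (rho * abs a) (a * z) = phi.[lprod L rho z].

(** The exponential function at a z is a polynomial in the exponential function
    at z, which interpolation makes explicit. *)
Lemma lattice_exp_lagrange L N a (s : 'I_N -> C) : discrete_group L -> a != 0 ->
  functional_equation N a L -> injective (fun i => abs (E L (s i))) ->
  forall z, E L (a * z) =
    lagrange_eval (fun i => E L (s i)) (fun i => E L (a * s i)) (E L z).
Proof.
move=> gL a0 fe injs z; have aa0 := uabs_gt0 a0.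
have scaled w : approx at_infinity (fun rho => lprod L (rho * abs a) w) (fun=> E L w).
  have [[M hM] h] := lprod_approx w gL; split; first by exists (abs (E L w)), 0 => rho _ /=.
  move=> e /h[rho0 hrho]; exists (rho0 / abs a) => rho le; apply: hrho.
  by rewrite -ler_pdivrMr.
set rhs := lagrange_eval _ _ _.
have [_ lag] : approx at_infinity (fun rho => lagrange_eval
    (fun i => lprod L rho (s i)) (fun i => lprod L (rho * abs a) (a * s i)) (lprod L rho z))
    (fun=> rhs).
  apply: approx_lagrange => [i|i||i j ji]; [exact: lprod_approx|exact: scaled|
    exact: lprod_approx|].
  exists (abs (E L (s i) - E L (s j))); last by exists 0 => rho _ /=.
  by apply: uabs_gt0; rewrite subr_eq0; apply: contra_neq ji => /(congr1 abs)/injs.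
apply/eqP; rewrite -subr_eq0; apply/negPn/negP => /uabs_gt0 e0.
(* Along large radii the products at the nodes have the absolute values of the
   exponential function, so they stay distinct. *)
have large : at_infinity [set rho | 0 < rho /\ forall i, abs (s i) < rho].
  exists (1 + \sum_i abs (s i)) => rho /= h; split.
    by apply: lt_le_trans h; rewrite ltr_wpDr // sumr_ge0.
  move=> i; apply: lt_le_trans h; rewrite (bigD1 i) //= addrCA ltrDl.
  by rewrite ltr_wpDr // sumr_ge0.
have [rho0 /(_ rho0 (lexx _)) /= [[h1 h2] [rho_gt0 hs]]] :=
  filterI (filterI ((scaled (a * z)).2 _ e0) (lag _ e0)) large.
have [phi sphi hphi] := fe _ rho_gt0.
have injl : injective (fun i => lprod L rho0 (s i)).
  move=> i j /(congr1 abs); rewrite -!(lattice_exp_abs gL complete) //; exact: injs.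
move: h2; rewrite (_ : lagrange_eval _ _ _ = lprod L (rho0 * abs a) (a * z)); last first.
  rewrite hphi (lagrange_evalE _ injl sphi); congr lagrange_eval.
  by apply/funext => i; rewrite hphi.
rewrite uabsBC in h1 => h2; have := uabsD_lt h1 h2.
by rewrite addrA subrK ltxx.
Qed.

Lemma discrete_min L : discrete_group L ->
  exists2 m : R, 0 < m & m <= 1 /\ forall l, L l -> l != 0 -> m <= abs l.
Proof.
move=> gL; pose s := [seq l <- lball L 1 | l != 0].
have memP l : L l -> l != 0 -> abs l <= 1 -> l \in s.
  by move=> Ll l0 l1; rewrite mem_filter l0; apply/(lballP gL).
have [[l0 l0s]|none] := pselect (exists l, l \in s); last first.
  exists 1 => //; split=> // l Ll l0; rewrite leNgt; apply/negP => /ltW l1.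
  by apply: none; exists l; exact: memP.
have [l ls lmin] := exists_minimizer abs l0s.
have := ls; rewrite mem_filter => /andP[ln0 /(lballP gL)[Ll l1]].
exists (abs l); first exact: uabs_gt0.
split=> // l' Ll' l'0; have [l'1|/ltW l'1] := leP (abs l') 1.
  by apply: lmin; exact: memP.
exact: le_trans l'1.
Qed.

Section Neighbourhoods.
Variables (L0 : set C) (gL0 : discrete_group L0) (Ls : set (set C)).

Local Notation near L d := (lattice_dist abs L0 L < d%:E)%E.

Definition uniformly_close (s : R) : Prop := forall e : R, 0 < e ->
  exists2 d : R, 0 < d & forall L, Ls L -> near L d ->
    forall z, abs z <= s -> abs (E L z - E L0 z) < e.

Lemma uniformly_close_le s s' : s <= s' -> uniformly_close s' -> uniformly_close s.
Proof.
move=> le h e /h[d d0 hd]; exists d => // L LL dL z zs.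
by apply: hd => //; exact: le_trans le.
Qed.

Lemma uniformly_close1 : uniformly_close 1.
Proof.
move=> e e0; exists e => // L _ dL z z1; rewrite uabsBC -lte_fin.
by apply: le_lt_trans dL; apply: ereal_sup_ubound; exists z.
Qed.

(** Neighbourhoods of L0, times a disc over which estimates are to be uniform. *)
Definition near_filter (s : R) : set_system (set C * C) :=
  [set A | exists2 d : R, 0 < d & forall L z, Ls L -> near L d -> abs z <= s -> A (L, z)].

Instance near_filter_filter s : Filter (near_filter s).
Proof.
split=> [|A B [d d0 hA] [d' d'0 hB]|A B AB [d d0 hA]].
- by exists 1.
- exists (Num.min d d') => [|L z LL dL zs]; first by rewrite lt_min d0 d'0.
  split; [apply: hA|apply: hB] => //; apply: lt_le_trans dL _;
    by rewrite lee_fin ge_min lexx ?orbT.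
by exists d => // L z LL dL zs; apply: AB; exact: hA.
Qed.

(** Closeness propagates to a larger disc through the functional equation: both
    the interpolation data and the argument are close. The same number N of
    nodes must serve for all the lattices. *)
Lemma uniformly_close_step N a p s : a != 0 -> 0 < abs p -> abs p < 1 -> 1 <= s ->
  functional_equation N a L0 ->
  (forall L, Ls L -> discrete_group L /\ functional_equation N a L) ->
  uniformly_close s -> uniformly_close (s * abs a).
Proof.
move=> a0 p0 p1 s1 fe0 hLs hs; have aa0 := uabs_gt0 a0.
have [m m0 [_ hm]] := discrete_min gL0.
have [k hk] : exists k, abs p ^+ k < Num.min m (Num.min 1 (abs a)^-1).
  by apply: powers_small => //; rewrite !lt_min m0 ltr01 invr_gt0.
move: hk; rewrite !lt_min => /and3P[km k1 ka].
(* Short interpolation nodes of distinct absolute values: the exponential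
   functions preserve these, hence separate the nodes. *)
pose x (i : 'I_N) := p ^+ (k + i).
have xk i : abs (x i) <= abs p ^+ k.
  rewrite uabsX exprD; apply: ler_piMr; first exact: exprn_ge0.
  by apply: exprn_ile1 => //; exact: ltW.
have xs i : abs (x i) <= s by apply: le_trans (xk i) (le_trans (ltW k1) s1).
have axs i : abs (a * x i) <= s.
  apply: le_trans s1; rewrite absM -ler_pdivlMl // mulr1.
  exact: le_trans (xk i) (ltW ka).
have Ex i : abs (E L0 (x i)) = abs (x i).
  by apply: (lattice_exp_small gL0 complete hm); exact: le_lt_trans (xk i) km.
have injx : injective (fun i => abs (x i)).
  move=> i j; rewrite !uabsX => h; apply/val_inj/(@addnI k) => /=.
  by move: h; apply: ieexprIn => //; rewrite lt_eqF.
pose G := near_filter s.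
have unif w : abs w <= s -> approx G (fun t => E t.1 w) (fun=> E L0 w).
  move=> ws; split; first by exists (abs (E L0 w)), 1 => // L z _ _ _ /=.
  by move=> e /hs[d d0 hd]; exists d => // L z LL dL _ /=; exact: hd.
have unifz : approx G (fun t => E t.1 t.2) (fun t => E L0 t.2).
  split.
    have [M hM] := lattice_exp_bounded gL0 complete s.
    by exists M, 1 => // L z _ _ zs /=; exact: hM.
  by move=> e /hs[d d0 hd]; exists d => // L z LL dL zs /=; exact: hd.
have [_ lag] : approx G
    (fun t => lagrange_eval (fun i => E t.1 (x i)) (fun i => E t.1 (a * x i)) (E t.1 t.2))
    (fun t => lagrange_eval (fun i => E L0 (x i)) (fun i => E L0 (a * x i)) (E L0 t.2)).
  apply: approx_lagrange => [i|i||i j ji]; [exact: unif|exact: unif|exact: unifz|].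
  exists (abs (E L0 (x i) - E L0 (x j))); last by exists 1 => // L z _ _ _ /=.
  apply: uabs_gt0; rewrite subr_eq0; apply: contra_neq ji => /(congr1 abs).
  by rewrite !Ex => /injx.
move=> e /lag[d d0 hd].
have [d' d'0 hd'] := hs (abs p ^+ (k + N)) (exprn_gt0 _ p0).
exists (Num.min d d') => [|L LL dL z za]; first by rewrite lt_min d0 d'0.
have [dL1 dL2] : near L d /\ near L d'.
  by split; apply: lt_le_trans dL _; rewrite lee_fin ge_min lexx ?orbT.
have [gL fe] := hLs L LL.
have ExL i : abs (E L (x i)) = abs (x i).
  rewrite -[RHS]Ex; apply: uabs_close; apply: lt_le_trans (hd' L LL dL2 _ (xs i)) _.
  rewrite Ex uabsX; apply: ler_wiXn2l; [exact: ltW|exact: ltW|].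
  by rewrite leq_add2l ltnW.
have zE : z = a * (z / a) by rewrite mulrCA mulfV // mulr1.
have zs : abs (z / a) <= s by rewrite absM uabsV ler_pdivrMr.
have := hd L (z / a) LL dL1 zs; rewrite /= [in E L z]zE [in E L0 z]zE.
rewrite -(lattice_exp_lagrange gL a0 fe) -1?(lattice_exp_lagrange gL0 a0 fe0) //.
  by move=> i j; rewrite !Ex; exact: injx.
by move=> i j; rewrite !ExL; exact: injx.
Qed.

Lemma uniformly_close_all N a p s : 1 < abs a -> 0 < abs p -> abs p < 1 ->
  functional_equation N a L0 ->
  (forall L, Ls L -> discrete_group L /\ functional_equation N a L) ->
  uniformly_close s.
Proof.
move=> a1 p0 p1 fe0 hLs.
have a0 : a != 0 by apply: contraTneq a1 => ->; rewrite uabs0 ltr10.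
have [n sn] := powers_unbounded s a1; apply: uniformly_close_le (ltW sn) _.
elim: n {sn} => [|n IH]; first by rewrite expr0; exact: uniformly_close1.
rewrite exprSr; apply: (@uniformly_close_step N a p) => //.
by rewrite exprn_ege1 // ltW.
Qed.

End Neighbourhoods.

(** ** Lattices as point sets *)

Definition close_in (rho eta : R) (L L' : set C) : Prop :=
  forall l, L l -> abs l <= rho -> exists2 l', L' l' & abs (l - l') <= eta.

Lemma uniformly_close_close_in L0 Ls rho eta : discrete_group L0 ->
  (forall L, Ls L -> discrete_group L) -> uniformly_close L0 Ls rho -> 0 < eta ->
  exists2 d : R, 0 < d & forall L, Ls L -> (lattice_dist abs L0 L < d%:E)%E ->
    close_in rho eta L0 L /\ close_in rho eta L L0.
Proof.
move=> gL0 gLs hrho /hrho[d d0 hd]; exists d => // L LL dL; have gL := gLs L LL.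
split=> l Ll lr; have := hd L LL dL l lr.
  rewrite (lattice_exp_zero gL0 complete Ll) subr0 => h.
  have [l' Ll' dl'] := lattice_exp_dist gL complete l.
  by exists l' => //; exact: le_trans dl' (ltW h).
rewrite (lattice_exp_zero gL complete Ll) sub0r uabsN => h.
have [l' Ll' dl'] := lattice_exp_dist gL0 complete l.
by exists l' => //; exact: le_trans dl' (ltW h).
Qed.

(** A short vector of L would have a multiple by a power of a of length between
    eta and m, close to no element of L0. *)
Lemma close_in_no_small L0 L a m rho eta : 1 < abs a -> 0 <= eta -> m <= rho ->
  eta * abs a < m -> (forall l, L0 l -> l != 0 -> m <= abs l) ->
  (forall l, L l -> L (a * l)) -> close_in rho eta L L0 ->
  forall l, L l -> l != 0 -> m <= abs l.
Proof.
move=> a1 eta0 mrho etam hm aL cl l Ll l0; rewrite leNgt; apply/negP => lm.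
have al n : L (a ^+ n * l).
  by elim: n => [|n IH]; rewrite ?expr0 ?mul1r // exprS -mulrA; exact: aL.
have ll0 := uabs_gt0 l0.
have [u Lu [eu um]] : exists2 u, L u & eta < abs u /\ abs u < m.
  have ex : exists n, eta < abs (a ^+ n * l).
    have [n hn] := powers_unbounded (eta / abs l) a1; exists n.
    by rewrite absM uabsX -ltr_pdivrMr.
  case: (ex_minnP ex) => -[|n] hn nmin; first by exists l => //; move: hn; rewrite mul1r.
  exists (a ^+ n.+1 * l) => //; split=> //; apply: le_lt_trans etam.
  rewrite exprS -mulrA absM mulrC ler_wpM2r // leNgt.
  by apply/negP => /nmin; rewrite ltnn.
have [l' Ll' dl'] := cl u Lu (le_trans (ltW um) mrho).
have E' : abs l' = abs u by apply: uabs_close; rewrite uabsBC; exact: le_lt_trans dl' eu.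
have l'0 : l' != 0.
  by apply: contraTneq (le_lt_trans eta0 eu) => z; rewrite -E' z uabs0 ltxx.
by have := hm l' Ll' l'0; rewrite E' leNgt um.
Qed.

(** Two lattices which are close in a large ball have close exponential
    functions on the unit disc: nearest points match the factors in the ball,
    and the remaining factors are uniformly close to 1. *)
Lemma close_in_exp L0 a e : discrete_group L0 -> 1 < abs a -> 0 < e ->
  exists rho eta, 0 < eta /\ forall L, discrete_group L ->
    (forall l, L l -> L (a * l)) -> close_in rho eta L0 L -> close_in rho eta L L0 ->
    forall z, abs z <= 1 -> abs (E L z - E L0 z) < e.
Proof.
move=> gL0 a1 e0; have [m m0 [m1 hm]] := discrete_min gL0.
have [M hM] := lattice_exp_bounded gL0 complete 1.
have M0 : 0 <= M by apply: le_trans (hM 0 _); rewrite ?uabs0.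
(* M' bounds both products at z, so that with this rho the tails are below e. *)
pose M' := M + e; have M'0 : 0 < M' by rewrite ltr_wpDl.
pose rho := 1 + M' / e; have rho1 : 1 < rho by rewrite ltrDl divr_gt0.
have rho0 : 0 < rho by exact: lt_trans rho1.
have M'rho : M' / rho < e.
  by rewrite ltr_pdivrMr // /rho mulrDr mulr1 mulrCA mulfV ?gt_eqF // mulr1 ltrDr.
have aa0 : 0 < abs a by exact: lt_trans a1.
pose n := size (lball L0 rho); pose B := m^-1.
have B1 : 1 <= B by rewrite /B invf_ge1.
have Bn0 : 0 < B ^+ n by rewrite exprn_gt0 // invr_gt0.
(* The first bound excludes short vectors of L; the second controls the product
   of the n factors, each at most B and within eta / m^2 of its counterpart. *)
pose eta := Num.min (m / abs a) (e * (m * m) / B ^+ n) / 2.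
have min0 : 0 < Num.min (m / abs a) (e * (m * m) / B ^+ n).
  by rewrite lt_min !divr_gt0 ?mulr_gt0.
have eta0 : 0 < eta by rewrite divr_gt0.
have : eta < Num.min (m / abs a) (e * (m * m) / B ^+ n).
  by rewrite /eta ltr_pdivrMr // ltr_pMr // ltr1n.
rewrite lt_min => /andP[etaa etae].
have etaam : eta * abs a < m by rewrite -ltr_pdivlMr.
have etam : eta < m by apply: le_lt_trans etaam; rewrite ler_peMr // ltW.
exists rho, eta; split=> // L gL aL cl0 cl z z1.
have mrho : m <= rho by exact: le_trans m1 (ltW rho1).
have hmL := close_in_no_small a1 (ltW eta0) mrho etaam hm aL cl.
have /choice[sg hsg] l : exists l', L0 l -> abs l <= rho -> L l' /\ abs (l - l') <= eta.
  have [[Ll lr]|no] := pselect (L0 l /\ abs l <= rho).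
    by have [l' Ll' h] := cl0 l Ll lr; exists l'.
  by exists 0 => Ll lr; case: no.
have uniq_near X l l' : (forall l, X l -> l != 0 -> m <= abs l) -> discrete_group X ->
    X l -> X l' -> abs (l - l') <= eta -> l = l'.
  move=> hX gX Xl Xl' d; apply/eqP; rewrite -subr_eq0; apply/negPn/negP => n0.
  have := le_lt_trans (le_trans (hX _ (groupB gX Xl Xl') n0) d) etam.
  by rewrite ltxx.
have sgP l : l \in lball L0 rho -> [/\ L0 l, L (sg l), abs (sg l) <= rho & abs (l - sg l) <= eta].
  move=> /(lballP gL0)[Ll lr]; have [Ls d] := hsg l Ll lr; split=> //.
  rewrite -[sg l](subKr l); apply: uabsB_le => //; apply: le_trans d _.
  exact: le_trans (ltW etam) mrho.
have perm_sg : perm_eq (lball L rho) [seq sg l | l <- lball L0 rho].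
  apply: uniq_perm; first exact: lball_uniq.
    rewrite map_inj_in_uniq ?lball_uniq // => l l' /sgP[Ll _ _ d] /sgP[Ll' _ _ d'] sE.
    apply: (uniq_near L0) => //; rewrite -[l](subrK (sg l)) -addrA; apply: uabsD_le => //.
    by rewrite uabsBC sE.
  move=> u; apply/idP/mapP => [/(lballP gL)[Lu ur]|[l /sgP[_ Ls sr _] ->]]; last first.
    by apply/(lballP gL).
  have [l Ll d] := cl u Lu ur.
  have lr : abs l <= rho.
    rewrite -[l](subKr u); apply: uabsB_le => //; apply: le_trans d _.
    exact: le_trans (ltW etam) mrho.
  have lb : l \in lball L0 rho by apply/(lballP gL0).
  exists l => //; have [_ Ls _ d'] := sgP l lb; apply: (uniq_near L) => //.
  by rewrite -[u](subrK l) -addrA; exact: uabsD_le.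
have sg0 l : l \in lball L0 rho -> (sg l == 0) = (l == 0).
  move=> lb; have [Ll Ls sr d] := sgP l lb; apply/eqP/eqP => h.
    by apply: (uniq_near L0) => //; [exact: group0|rewrite -h].
  by apply: (uniq_near L) => //; [exact: group0|rewrite uabsBC -h].
have zrho : abs z < rho by exact: le_lt_trans rho1.
have Bm l : m <= abs l -> abs (1 - z / l) <= B.
  move=> ml; apply: uabsB_le; rewrite ?uabs1 // absM uabsV /B -[leRHS]mul1r.
  by rewrite ler_pM ?invr_ge0 // lef_pV2 // posrE (lt_le_trans m0).
have [near _] : abs (\prod_(l <- lball L0 rho | l != 0) (1 - z / sg l) -
    \prod_(l <- lball L0 rho | l != 0) (1 - z / l)) <= B ^+ n * (eta / (m * m)) /\
    abs (\prod_(l <- lball L0 rho | l != 0) (1 - z / sg l)) <= B ^+ n.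
  apply: uabs_prod_near => // [|l lb l0]; first by rewrite divr_ge0 ?mulr_ge0 // ltW.
  have [Ll Ls _ d] := sgP l lb; have sl0 : sg l != 0 by rewrite sg0.
  have ml := hm l Ll l0; have ms := hmL _ Ls sl0; split; try exact: Bm.
  rewrite (_ : _ - _ = z * ((sg l - l) / (l * sg l))); last by field; rewrite ?l0 ?sl0.
  rewrite absM -[leRHS]mul1r; apply: ler_pM => //.
  rewrite absM uabsV absM uabsBC; apply: ler_pM => //; first by rewrite invr_ge0 mulr_ge0.
  by rewrite lef_pV2 ?posrE ?mulr_gt0 ?uabs_gt0 // ler_pM // ltW.
have dprod : abs (lprod L rho z - lprod L0 rho z) < e.
  rewrite /lprod (perm_big _ perm_sg) big_map -mulrBr absM.
  have -> : \prod_(l <- lball L0 rho | sg l != 0) (1 - z / sg l) =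
            \prod_(l <- lball L0 rho | l != 0) (1 - z / sg l).
    rewrite big_seq_cond [RHS]big_seq_cond; apply: eq_bigl => l.
    by case: (boolP (l \in _)) => //= lb; rewrite sg0.
  apply: le_lt_trans (ler_pM _ _ z1 near) _ => //; rewrite mul1r.
  rewrite mulrA ltr_pdivrMr ?mulr_gt0 //.
  by move: etae; rewrite ltr_pdivlMr // mulrC.
have P0M : abs (lprod L0 rho z) <= M by rewrite -(lattice_exp_abs gL0 complete zrho) hM.
have PM : abs (lprod L rho z) <= M'.
  rewrite -[lprod L rho z](subrK (lprod L0 rho z)); apply: uabsD_le.
    by apply: le_trans (ltW dprod) _; rewrite lerDr.
  by apply: le_trans P0M _; rewrite lerDl ltW.
have tail X : discrete_group X -> abs (lprod X rho z) <= M' ->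
    abs (E X z - lprod X rho z) < e.
  move=> gX XM; apply: le_lt_trans (lattice_exp_approx gX complete rho0 (ltW zrho)) _.
  apply: le_lt_trans M'rho; apply: ler_pM => //; first by rewrite divr_ge0 // ltW.
  by rewrite ler_pdivrMr // mulVf ?gt_eqF.
rewrite (_ : _ - _ = (E L z - lprod L rho z) + ((lprod L rho z - lprod L0 rho z) -
   (E L0 z - lprod L0 rho z))); last by ring.
apply: uabsD_lt; first exact: tail.
apply: uabsD_lt => //; rewrite uabsN; apply: tail => //.
by apply: le_trans P0M _; rewrite lerDl ltW.
Qed.

End Uniform.

End Ultrametric.

(** * Lattices and their multiples by ideals *)

Section IdealLattices.
Variables (R : realType) (K : finFieldType) (F : fieldType) (cK : {rmorphism K -> F}).
Hypothesis bdep : bounded_dependent cK.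
Variables (oo : F -> int) (voo : valuation oo).
Hypothesis constants : forall x, algebraicOver cK x -> exists a, x = cK a.
Variables (C : fieldType) (iota : {rmorphism F -> C}) (abs : C -> R).
Hypothesis uabs : ultrametric_abs abs.
Hypothesis complete : forall u, cauchy_seq abs u -> exists l, converges abs u l.
Hypothesis pseudo_uniformiser : exists p, 0 < abs p < 1.

Local Notation A := (regular oo).
Local Notation sA := (@regular_subring F oo).
Local Notation act := (iota_act iota).
Local Notation latt := (lattices A iota abs).
Local Notation latt_le := (lattices_le A iota abs).

Lemma iota_vector_action : vector_action act.
Proof.
by split=> *; rewrite /iota_act ?rmorphD ?rmorphM ?rmorph1 ?mulrDl ?mulrDr ?mulrA ?mul1r.
Qed.

Local Notation vact := iota_vector_action.

Lemma lattice_submodule L : lattice A iota abs L -> submodule A act L.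
Proof. by move=> [fg _]; exact: (fg_submodule_submodule sA vact). Qed.

Lemma lattice_discrete_group L : lattice A iota abs L -> discrete_group abs L.
Proof.
move=> lL; have sL := lattice_submodule lL; have [_ disc] := lL; split=> //.
  exact: submodule0 sL.
move=> z w Lz Lw; apply: (submoduleD sL) => //; rewrite -mulN1r.
have -> : -1 = iota (-1) by rewrite rmorphN1.
by apply: (submodule_act sL) => //; apply: regularN; exact: (@regular1 F oo).
Qed.

Lemma lattice_le_lattice r L : latt_le r L -> lattice A iota abs L.
Proof. by move=> [s _ []]. Qed.

Lemma uabs_sum_le (I : Type) (r : seq I) (P : pred I) (f : I -> C) M : 0 <= M ->
  (forall i, P i -> abs (f i) <= M) -> abs (\sum_(i <- r | P i) f i) <= M.
Proof.
move=> M0 h; apply: (big_ind (fun z => abs z <= M)) => //; first by rewrite (uabs0 uabs).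
by move=> x y; exact: uabsD_le.
Qed.

(** ** The uniform functional equation *)

(** For b regular and transcendental, L / b L has bounded size when the rank of
    L is bounded: elements independent over the constants modulo b L are
    independent over K[b], and the span of L over K(b) has dimension at most
    n r. *)
Lemma lattice_functional_equation b r : A b -> transcendental cK b ->
  exists N, forall L, latt_le r L -> functional_equation abs N (iota b) L.
Proof.
move=> Ab tb; have [n hn] := bdep b.
exists (#|K| ^ (n * r)).+1 => L LL rho rho0.
have lL := lattice_le_lattice LL; have sL := lattice_submodule lL.
have gL := lattice_discrete_group lL; have [s sr [_ [v [Lv indv spanv]]]] := LL.
have b0 : iota b != 0.
  rewrite fmorph_eq0; have := tb 'X; rewrite pevX; by apply; rewrite polyX_eq0.
pose cC : {rmorphism K -> C} := iota \o cK.
have LZ a m : L m -> L (cC a * m).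
  by apply: (submodule_act sL); exact: regular_const.
have Lb m : L m -> L (iota b * m) by exact: (submodule_act sL).
have evE p : pev cC (iota b) p = iota (pev cK b p).
  by rewrite /pev map_poly_comp /= horner_map.
have bnd N (f : 'I_N -> C) : indep_mod cC (iota b) L f -> (N <= n * s)%N.
  move=> indf; rewrite leqNgt; apply/negP => lt; have [Lf _] := indf.
  have /choice[x hx] i := spanv (f i) (Lf i).
  have [p [p0 hp]] := hn s N x lt.
  apply: (indep_mod_free b0 (group0 gL) (submoduleD sL) LZ Lb indf).
  exists p; split=> //; under eq_bigr => i _ do rewrite hx mulr_sumr.
  rewrite exchange_big big1 //= => k _; rewrite /iota_act.
  under eq_bigr => i _ do rewrite evE mulrA -rmorphM.
  by rewrite -mulr_suml -rmorph_sum hp rmorph0 mul0r.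
have [k [f [kn [Lf indf] span]]] := spanning_mod (group0 gL) LZ bnd.
pose rep (t : {ffun 'I_k -> K}) := \sum_i cC (t i) * f i.
have repB t t' : rep t - rep t' = \sum_i cC (t i - t' i) * f i.
  by rewrite -sumrB; apply: eq_bigr => i _; rewrite rmorphB mulrBl.
have [|l Ll|phi sphi hphi] := lprod_functional uabs gL (rep := rep) b0 (ltW rho0).
- exact: Lb.
- have [a [m' [Lm' E]]] := span l Ll.
  have lE : l - rep (finfun a) = iota b * m'.
    rewrite E addrAC -[RHS]add0r; congr (_ + _); apply/eqP; rewrite subr_eq0; apply/eqP.
    by apply: eq_bigr => i _; rewrite ffunE.
  exists (finfun a); first by exists m'.
  move=> t [m Lm tE]; apply/ffunP => i; apply/eqP; rewrite -subr_eq0; apply/eqP.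
  apply: (indf (fun i => t i - finfun a i)); exists (m' - m); first exact: (groupB gL).
  by rewrite -repB mulrBr -lE -tE; ring.
exists phi => //; apply: leq_trans sphi _; rewrite ltnS card_ffun card_ord.
rewrite leq_exp2l ?finRing_gt1 //; apply: leq_trans kn _.
by rewrite leq_mul2l sr orbT.
Qed.

(** The powers of b act on a nonzero lattice by distinct elements, which cannot
    all lie in one ball. *)
Lemma lattice_abs_gt1 b L l : A b -> transcendental cK b ->
  lattice A iota abs L -> L l -> l != 0 -> 1 < abs (iota b).
Proof.
move=> Ab tb lL Ll l0; rewrite ltNge; apply/negP => b1.
have gL := lattice_discrete_group lL.
pose s := lball abs L (abs l); pose g (i : 'I_(size s).+1) := iota (b ^+ i) * l.
have injg : injective g.
  move=> i j /(mulIf l0)/fmorph_inj bij; apply/val_inj/eqP/negPn/negP => ij.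
  have nz : 'X^i - 'X^j != 0 :> {poly K}.
    rewrite subr_eq0; apply: contra ij => /eqP/(congr1 (size \o polyseq)) /=.
    by rewrite !size_polyXn => -[->].
  by have := tb _ nz; rewrite rmorphB !rmorphXn /= pevX bij subrr eqxx.
have sub : {subset [seq g i | i <- enum 'I_(size s).+1] <= s}.
  move=> _ /mapP[i _ ->]; apply/(lballP gL); split.
    by apply: (submodule_act (lattice_submodule lL)) => //; exact: regularX.
  rewrite (uabsM uabs) rmorphXn (uabsX uabs) ler_piMl ?(uabs_ge0 uabs) //.
  by rewrite exprn_ile1 // (uabs_ge0 uabs).
have := uniq_leq_size _ sub; rewrite map_inj_uniq ?enum_uniq // => /(_ isT).
by rewrite size_map size_enum_ord ltnn.
Qed.

(** ** Multiplication by an invertible ideal *)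

Section OneIdeal.
Variables (J : set F) (fJ : fractional_ideal A J).

Local Notation I := (ideal_inv A J).

Let invJ : ideal_mul I J 1 := ideal_inv_mul bdep voo constants fJ.
Let fI : fractional_ideal A I := fractional_ideal_inv bdep voo constants fJ.

Lemma ideal_latticeP L v : submodule A act L ->
  ideal_lattice iota I L v <-> forall y, J y -> L (iota y * v).
Proof. by move=> sL; exact: (ideal_inv_prodP vact v invJ sL). Qed.

Lemma ideal_lattice_lattices s L : latt s L -> latt s (ideal_lattice iota I L).
Proof.
move=> [lL rkL]; have [fgL disc] := lL; have [fgI nzI] := fI.
split; last exact: (has_rank_module_prod vact).
split=> [|rho]; first exact: (fg_module_prod sA vact).
have [_ [y Jy y0]] := fJ; have iy0 : iota y != 0 by rewrite fmorph_eq0.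
apply: (@sub_finite_set _ _ ((fun z => (iota y)^-1 * z) @`
    (L `&` [set z | abs z <= abs (iota y) * rho]))); last exact/finite_image.
move=> z [/(ideal_latticeP z (lattice_submodule lL)) hz zr].
exists (iota y * z); last by rewrite mulKf.
by split; [exact: hz|rewrite /= (uabsM uabs) ler_wpM2l ?(uabs_ge0 uabs)].
Qed.

Lemma ideal_lattice_le s L : latt_le s L -> latt_le s (ideal_lattice iota I L).
Proof. by move=> [t ts Lt]; exists t => //; exact: ideal_lattice_lattices. Qed.

(** With 1 the sum of the x_k y_k, a point l of I L is the sum of the
    x_k (y_k l) with y_k l in L; approximating each y_k l approximates l. *)
Lemma close_in_ideal rho eta : 0 < eta -> exists rho' eta', 0 < eta' /\
  forall L L', submodule A act L -> submodule A act L' ->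
    close_in abs rho' eta' L L' ->
    close_in abs rho eta (ideal_lattice iota I L) (ideal_lattice iota I L').
Proof.
move=> eta0; have [n [x [y [Ix Jy E]]]] := invJ.
pose X := 1 + \sum_k abs (iota (x k)); pose Y := 1 + \sum_k abs (iota (y k)).
have sum0 (z : 'I_n -> F) : 0 <= \sum_k abs (iota (z k)).
  by apply: sumr_ge0 => k _; exact: uabs_ge0.
have le_sum (z : 'I_n -> F) k : abs (iota (z k)) <= 1 + \sum_k abs (iota (z k)).
  rewrite (bigD1 k) //= addrCA lerDl addr_ge0 //.
  by apply: sumr_ge0 => j _; exact: uabs_ge0.
have X0 : 0 < X by rewrite ltr_pwDl.
exists (Y * Num.max rho 0), (eta / X); split; first exact: divr_gt0.
move=> L L' sL sL' cl l /(ideal_latticeP l sL) hl lr.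
have /choice[mu hmu] k : exists m, L' m /\ abs (iota (y k) * l - m) <= eta / X.
  have [|m Lm d] := cl (iota (y k) * l) (hl _ (Jy k)); last by exists m.
  rewrite (uabsM uabs) ler_pM ?(uabs_ge0 uabs) ?le_sum //.
  by rewrite le_max lr.
exists (\sum_k act (x k) (mu k)).
  by exists n, x, mu; split=> // k; have [] := hmu k.
have -> : l - \sum_k act (x k) (mu k) = \sum_k iota (x k) * (iota (y k) * l - mu k).
  have -> : l = \sum_k iota (x k) * (iota (y k) * l).
    rewrite -{1}[l]mul1r -(rmorph1 iota) E rmorph_sum mulr_suml.
    by apply: eq_bigr => k _; rewrite rmorphM mulrA.
  rewrite -sumrB; apply: eq_bigr => k _; rewrite /iota_act mulrBr; congr (_ - _).
  congr (_ * (_ * _)); rewrite -[LHS]mul1r -(rmorph1 iota) E rmorph_sum mulr_suml.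
  by apply: eq_bigr => j _; rewrite rmorphM mulrA.
apply: uabs_sum_le => [|k _]; first exact: ltW.
rewrite (uabsM uabs); have [_ d] := hmu k.
apply: le_trans (ler_pM (uabs_ge0 uabs _) (uabs_ge0 uabs _) (le_sum x k) d) _.
by rewrite -/X mulrCA mulfV ?mulr1 // gt_eqF.
Qed.

(** When exponential functions are close on a large disc, the lattices are close
    as point sets, then so are their multiples by I, and then the exponential
    functions of these. Closeness on large discs needs a regular function of
    absolute value > 1, which exists as soon as some lattice is nonzero. *)
Lemma ideal_lattice_continuous r L : latt_le r L -> forall e : R, 0 < e ->
  exists2 d : R, 0 < d & forall L', latt_le r L' ->
    (lattice_dist abs L L' < d%:E)%E ->
    (lattice_dist abs (ideal_lattice iota I L) (ideal_lattice iota I L') < e%:E)%E.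
Proof.
move=> LL e e0.
have dist_lt X Y e' : e' < e -> (forall z, abs z <= 1 ->
    abs (lattice_exp abs Y z - lattice_exp abs X z) <= e') ->
    (lattice_dist abs X Y < e%:E)%E.
  move=> e'e h; apply: (@le_lt_trans _ _ e'%:E); last by rewrite lte_fin.
  apply: ge_ereal_sup => _ [z z1 <-]; rewrite lee_fin (uabsBC uabs); exact: h.
have [[M [LM [l Ml l0]]]|triv] :=
    pselect (exists M, latt_le r M /\ exists2 l, M l & l != 0); last first.
  have zero X : latt_le r X -> X = [set 0].
    move=> LX; have lX := lattice_le_lattice LX; apply/seteqP; split=> z.
      move=> Xz; apply/eqP/negPn/negP => z0; apply: triv; exists X; split=> //.
      by exists z.
    by move=> ->; exact: (submodule0 (lattice_submodule lX)).
  exists 1 => // L' LL' _; apply: (dist_lt _ _ 0) => // z _.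
  by rewrite (zero _ LL) (zero _ LL') subrr (uabs0 uabs).
have [b [Ab tb]] := regular_transcendental bdep voo constants.
have b1 := lattice_abs_gt1 Ab tb (lattice_le_lattice LM) Ml l0.
have [N fe] := lattice_functional_equation r Ab tb.
have [p /andP[p0 p1]] := pseudo_uniformiser.
have grp X : latt_le r X -> discrete_group abs X.
  by move=> LX; exact: lattice_discrete_group (lattice_le_lattice LX).
have sub X : latt_le r X -> submodule A act X.
  by move=> LX; exact: lattice_submodule (lattice_le_lattice LX).
have e20 : 0 < e / 2 by rewrite divr_gt0.
have gIL := grp _ (ideal_lattice_le LL).
have [rho [eta [eta0 hexp]]] := close_in_exp uabs complete gIL b1 e20.
have [rho' [eta' [eta'0 hcl]]] := close_in_ideal rho eta0.
have unif : uniformly_close abs L (latt_le r) rho'.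
  apply: (uniformly_close_all uabs complete (grp _ LL) _ b1 p0 p1 (fe _ LL)) => X LX.
  by split; [exact: grp|exact: fe].
have [d d0 hd] := uniformly_close_close_in uabs complete (grp _ LL) grp unif eta'0.
exists d => // L' LL' dL'; have [c1 c2] := hd L' LL' dL'.
apply: (dist_lt _ _ (e / 2)); first by rewrite ltr_pdivrMr // ltr_pMr // ltr1n.
move=> z z1; apply/ltW/hexp => //.
- exact: (grp _ (ideal_lattice_le LL')).
- by move=> m; apply: (submodule_act (sub _ (ideal_lattice_le LL'))).
- by apply: hcl; rewrite //; exact: sub.
by apply: hcl; rewrite //; exact: sub.
Qed.

Lemma ideal_lattice_scale t L : ideal_lattice iota I (lattice_scale t L) =
  lattice_scale t (ideal_lattice iota I L).
Proof.
apply/seteqP; split=> [v [n [x [y [Ix My ->]]]]|_ [_ [n [x [y [Ix My ->]]]] <-]].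
  have /choice[w hw] i : exists w, L w /\ t * w = y i.
    by have [w Lw <-] := My i; exists w.
  exists (\sum_i act (x i) (w i)).
    by exists n, x, w; split=> // i; have [] := hw i.
  rewrite mulr_sumr; apply: eq_bigr => i _; have [_ <-] := hw i.
  by rewrite /iota_act mulrCA.
exists n, x, (fun i => t * y i); split=> // [i|]; first by exists (y i).
by rewrite mulr_sumr; apply: eq_bigr => i _; rewrite /iota_act mulrCA.
Qed.

(** Multiplication by I commutes with the F-linear map given by psi. *)
Lemma ideal_lattice_period r (psi : 'rV[C]_r) (Y : set 'cV[F]_r) :
  ideal_lattice iota I (period_lattice iota psi Y) =
  period_lattice iota psi (module_prod *:%R I Y).
Proof.
pose ell (y : 'cV[F]_r) := \sum_i psi 0 i * iota (y i 0).
have ellE n (x : 'I_n -> F) (y : 'I_n -> 'cV[F]_r) :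
    ell (\sum_k x k *: y k) = \sum_k act (x k) (ell (y k)).
  rewrite /ell; under [RHS]eq_bigr do rewrite /iota_act mulr_sumr.
  rewrite exchange_big; apply: eq_bigr => i _ /=.
  rewrite summxE rmorph_sum mulr_sumr; apply: eq_bigr => k _.
  by rewrite !mxE rmorphM mulrCA.
apply/seteqP; split=> [v [n [x [y [Ix My ->]]]]|_ [_ [n [x [y [Ix My ->]]]] <-]].
  have /choice[w hw] i : exists w, Y w /\ ell w = y i.
    by have [w Yw <-] := My i; exists w.
  exists (\sum_i x i *: w i).
    by exists n, x, w; split=> // i; have [] := hw i.
  rewrite -/(ell _) ellE; apply: eq_bigr => i _.
  by have [_ ->] := hw i.
exists n, x, (fun k => ell (y k)); split=> // [k|]; first by exists (y k).
exact: ellE.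
Qed.

Variables (delta : nat) (k : int).

Lemma strong_form_slash r f : strong_form K delta A iota abs k r f ->
  strong_form K delta A iota abs k r (slash A iota J f).
Proof.
move=> [fc fh fhol]; split.
- move=> L LL e e0; have [d d0 hd] := fc _ (ideal_lattice_le LL) e e0.
  have [d' d'0 hd'] := ideal_lattice_continuous LL d0.
  by exists d' => // L' LL' dL'; apply: hd; [exact: ideal_lattice_le|exact: hd'].
- move=> L LL t t0; rewrite /slash ideal_lattice_scale.
  by apply: fh => //; exact: ideal_lattice_le.
move=> Y fgY rkY; have [fgI nzI] := fI.
have vY : vector_action ( *:%R : F -> 'cV[F]_r -> 'cV[F]_r).
  by split=> *; rewrite ?scalerDl ?scalerDr ?scalerA ?scale1r.
have := fhol _ (fg_module_prod sA vY fgI fgY) (has_rank_module_prod vY nzI rkY).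
rewrite (_ : (fun psi => _) = (fun psi => slash A iota J f (period_lattice iota psi Y))) //.
by apply/funext => psi; rewrite /slash ideal_lattice_period.
Qed.

Lemma cusp_form_slash r f : cusp_form K delta A iota abs k r f ->
  cusp_form K delta A iota abs k r (slash A iota J f).
Proof.
move=> [sf f0]; split; first exact: strong_form_slash.
by move=> L LL; apply: f0; exact: ideal_lattice_le.
Qed.

End OneIdeal.

Lemma ideal_lattice_inv1 L : submodule A act L -> ideal_lattice iota (ideal_inv A A) L = L.
Proof.
move=> sL; have invA x : ideal_inv A A x -> A x.
  by move=> /(_ 1 (@regular1 F oo)); rewrite mulr1.
apply/seteqP; split.
  apply: module_prod_ind => [||x m /invA Ax Lm].
  - exact: submodule0 sL.
  - exact: submoduleD sL.
  exact: (submodule_act sL).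
move=> v Lv; rewrite -[v](vact1 vact); apply: module_prod_mem => // y Ay.
by rewrite mul1r.
Qed.

Lemma fractional_ideal_mul J J' : fractional_ideal A J -> fractional_ideal A J' ->
  fractional_ideal A (ideal_mul J J').
Proof.
move=> [fgJ [x Jx x0]] [fgJ' [y Jy y0]]; split.
  exact: (fg_module_prod sA (mul_action F)).
by exists (x * y); [exact: module_prod_mem|exact: mulf_neq0].
Qed.

(** Both sides consist of the v with x y v in L for all x in J and y in J'. *)
Lemma ideal_lattice_mul J J' L : fractional_ideal A J -> fractional_ideal A J' ->
  submodule A act L -> submodule A act (ideal_lattice iota (ideal_inv A J') L) ->
  ideal_lattice iota (ideal_inv A (ideal_mul J J')) L =
  ideal_lattice iota (ideal_inv A J) (ideal_lattice iota (ideal_inv A J') L).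
Proof.
move=> fJ fJ' sL sJL.
apply/seteqP; split=> v.
  move=> /(ideal_latticeP (fractional_ideal_mul fJ fJ') v sL) h.
  apply/(ideal_latticeP fJ) => // x Jx; apply/(ideal_latticeP fJ') => // y Jy.
  by rewrite mulrA -rmorphM mulrC [y * x]mulrC mulrC; apply: h; exact: module_prod_mem.
move=> /(ideal_latticeP fJ v sJL) h; apply/(ideal_latticeP (fractional_ideal_mul fJ fJ')) => //.
move=> z [n [x [y [Jx Jy ->]]]]; rewrite rmorph_sum mulr_suml.
apply: (big_ind L) => [||i _]; [exact: submodule0 sL|exact: (submoduleD sL)|].
rewrite rmorphM [iota (x i) * _]mulrC -mulrA.
by have /(ideal_latticeP fJ' _ sL) := h _ (Jx i); apply.
Qed.

End IdealLattices.

(** * The action of fractional ideals *)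

Section Specialisation.
Variables (K : finFieldType) (F : fieldExtType {fraction {poly K}}).

Lemma place_valuation (w : F -> int) : place w <-> valuation w.
Proof. by split=> -[h0 hM hD hn]; split. Qed.

Lemma regular_awayE (oo : F -> int) : regular_away oo = regular oo.
Proof. by apply/seteqP; split=> a h w /place_valuation; exact: h. Qed.

Lemma is_Cinf_ultrametric (R : realType) (oo : F -> int) (delta : nat) (C : fieldType)
    (iota : {rmorphism F -> C}) (abs : C -> R) :
  is_Cinf iota abs (place_abs R oo delta) -> ultrametric_abs abs.
Proof.
move=> [a0 aM aD ai _ _ _]; split=> // z.
(* The values of abs are not given to be nonnegative, except on F. *)
have aN1 : abs (-1) = 1.
  have a1 : abs 1 = 1.
    have nz : abs 1 != 0 by apply/eqP => /a0/eqP; rewrite oner_eq0.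
    by apply: (mulfI nz); rewrite -aM !mulr1.
  have /eqP : abs (-1) * abs (-1) = 1 by rewrite -aM mulrNN mulr1.
  rewrite -expr2 sqrf_eq1 => /orP[/eqP //|/eqP h].
  have : 0 <= abs (iota (-1)).
    rewrite ai /place_abs; case: ifP => // _.
    by rewrite exprz_ge0.
  by rewrite rmorphN1 h oppr_ge0 ler10.
have := aD z (- z); rewrite subrr -mulN1r aM aN1 mul1r maxxx.
by rewrite (_ : abs 0 = 0) //; exact/a0.
Qed.

Lemma place_degree_gt0 (oo : F -> int) delta :
  place oo -> place_degree oo delta -> (0 < delta)%N.
Proof.
move=> /place_valuation voo [b [_ hb]]; case: delta b hb => // b hb.
have [|c [+ _]] := hb 1; first by rewrite (val1 voo).
rewrite big_ord0 subr0 => -[/eqP|]; first by rewrite oner_eq0.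
by rewrite (val1 voo) ltxx.
Qed.

End Specialisation.

Theorem proposition16 (R : realType) (K : finFieldType)
    (F : fieldExtType {fraction {poly K}}) (oo : F -> int) (delta : nat)
    (C : fieldType) (iota : {rmorphism F -> C}) (abs : C -> R)
    (HK : full_constant_field F)
    (Hoo : place oo) (Hdelta : place_degree oo delta)
    (HC : is_Cinf iota abs (place_abs R oo delta))
    (r : nat) (Hr : (1 <= r)%N) (k : int) :
  let A := regular_away oo in
  let Lle := lattices_le A iota abs r in
  let Strong := strong_form K delta A iota abs k r in
  let Cusp := cusp_form K delta A iota abs k r in
  let act := slash A iota in
  (* f|J is well defined on the lattices of rank <= r *)
  (forall J, fractional_ideal A J -> forall L, Lle L ->
     Lle (ideal_lattice iota (ideal_inv A J) L)) /\
  (* J acts on the space of strong forms, linearly *)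
  (forall J, fractional_ideal A J -> forall f, Strong f -> Strong (act J f)) /\
  (forall J, fractional_ideal A J -> forall (a : C) f g, Strong f -> Strong g ->
     forall L, Lle L ->
       act J (fun M => a * f M + g M) L = a * act J f L + act J g L) /\
  (* the group laws; A is the identity of the group of fractional ideals *)
  (forall f, Strong f -> forall L, Lle L -> act A f L = f L) /\
  (forall I J, fractional_ideal A I -> fractional_ideal A J ->
     forall f, Strong f -> forall L, Lle L ->
       act (ideal_mul I J) f L = act J (act I f) L) /\
  (* cusp forms are mapped to cusp forms *)
  (forall J, fractional_ideal A J -> forall f, Cusp f -> Cusp (act J f)).
Proof.
rewrite regular_awayE => A Lle Strong Cusp act.
have /place_valuation voo := Hoo.
have constants : forall x, algebraicOver (@Defs.cst K F) x -> exists a, x = Defs.cst F a.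
  exact: HK.
have bdep := @bounded_dependence K F.
have uabs := is_Cinf_ultrametric HC.
have complete := abs_complete HC.
have pseudo_uniformiser : exists p, 0 < abs p < 1.
  have [u u0 oou] := place_normalised Hoo; exists (iota u).
  rewrite (abs_iota HC) /place_abs (negPf u0) oou mulr1 -exprnN -exprVn.
  have q1 : (1 : R) < #|K|%:R by rewrite ltr1n finRing_gt1.
  have q0 : (0 : R) < #|K|%:R by exact: lt_trans q1.
  rewrite exprn_gt0 ?invr_gt0 // exprn_ilt1 ?invr_ge0 ?(ltW q0) ?invf_lt1 //.
  by rewrite -lt0n (place_degree_gt0 Hoo Hdelta).
have sub L : Lle L -> submodule A (iota_act iota) L.
  by move=> LL; exact: lattice_submodule (lattice_le_lattice LL).
have le J : fractional_ideal A J -> forall L, Lle L ->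
    Lle (ideal_lattice iota (ideal_inv A J) L).
  by move=> fJ L; exact: (ideal_lattice_le bdep voo constants uabs fJ).
split; first exact: le.
split; first by move=> J fJ f; exact: strong_form_slash.
split; first by [].
split; first by move=> f _ L LL; rewrite /act /slash ideal_lattice_inv1 //; exact: sub.
split; last by move=> J fJ f; exact: cusp_form_slash.
move=> I J fI fJ f _ L LL; rewrite /act /slash (ideal_lattice_mul bdep voo constants fI fJ) //.
  exact: sub.
exact/sub/le.
Qed.
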